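(* Let $r>0$. There exists $\delta=\delta(r)>0$ such that for every $\mathbf{n}\in\mathcal{M}$ with $0<\|\mathbf{n}-\mathbf{e}_3\|_{L^2(\mathbb{R}^2)}\le\delta$ one has $E_r[\mathbf{n}]>E_r[\mathbf{e}_3]$ (where $E_r[\mathbf{e}_3]=0$).
   Context: Maps $\mathbf{n}=(n_1,n_2,n_3):\mathbb{R}^2\to\mathbb{S}^2\subset\mathbb{R}^3$ (with weak derivatives in $L^2_{loc}$); $\mathbf{e}_1,\mathbf{e}_2,\mathbf{e}_3$ is the canonical basis of $\mathbb{R}^3$. Define $D[\mathbf{n}]=\frac12\int_{\mathbb{R}^2}|\nabla\mathbf{n}|^2dx$, $H[\mathbf{n}]=\int_{\mathbb{R}^2}(\mathbf{n}-\mathbf{e}_3)\cdot(\nabla\times\mathbf{n})dx$ where $\nabla\times\mathbf{n}=(\partial_2 n_3,-\partial_1 n_3,\partial_1 n_2-\partial_2 n_1)$, $V[\mathbf{n}]=\frac18\int_{\mathbb{R}^2}|\mathbf{n}-\mathbf{e}_3|^4dx$, and $E_r=D+rH+V$ for $r>0$. The energy space is $\mathcal{M}=\{\mathbf{n}:\mathbb{R}^2\to\mathbb{S}^2\mid D[\mathbf{n}]+V[\mathbf{n}]<\infty\}$. *)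

(* Defs.v *)
From HB Require Import structures.
From mathcomp Require Import all_boot all_order all_algebra.
From mathcomp Require Import all_classical all_reals all_analysis.
Set Implicit Arguments. Unset Strict Implicit. Unset Printing Implicit Defensive.
Import Order.TTheory GRing.Theory Num.Theory.
Import numFieldNormedType.Exports.
Local Open Scope classical_set_scope.
Local Open Scope ring_scope.

Section Defs.
Variable R : realType.

Definition leb2 := (@lebesgue_measure R \x @lebesgue_measure R)%E.

Definition partial (j : 'I_2) (f : R * R -> R) : R * R -> R :=
  fun p => if (j == 0 :> nat) then derive1 (fun t => f (t, p.2)) p.1
           else derive1 (fun t => f (p.1, t)) p.2.

Definition partial_derivable (j : 'I_2) (f : R * R -> R) (p : R * R) : Prop :=
  if (j == 0 :> nat) then derivable (fun t => f (t, p.2)) p.1 1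
  else derivable (fun t => f (p.1, t)) p.2 1.

Definition iter_partial (s : seq 'I_2) (f : R * R -> R) : R * R -> R :=
  foldr partial f s.

Definition smooth (f : R * R -> R) : Prop :=
  forall s : seq 'I_2, continuous (iter_partial s f) /\
    forall (j : 'I_2) (p : R * R), partial_derivable j (iter_partial s f) p.

Definition test_fun (phi : R * R -> R) : Prop :=
  smooth phi /\ compact (closure [set p | phi p != 0]).

Definition weak_deriv (f g : R * R -> R) (j : 'I_2) : Prop :=
  forall phi, test_fun phi ->
    (\int[leb2]_p (f p * partial j phi p)%:E
       = - \int[leb2]_p (g p * phi p)%:E)%E.

Definition L2loc (g : R * R -> R) : Prop :=
  measurable_fun setT g /\
  forall K : set (R * R), compact K ->
    (\int[leb2]_(p in K) (g p ^+ 2)%:E < +oo)%E.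

(* maps R^2 -> S^2, components indexed by 'I_3 (n_1,n_2,n_3 = n 0, n 1, n 2) *)
Definition sphere_map (n : 'I_3 -> R * R -> R) : Prop :=
  (forall i, measurable_fun setT (n i)) /\
  {ae leb2, forall p, \sum_(i < 3) n i p ^+ 2 = 1}.

Definition e3 (i : 'I_3) : R := ((i : nat) == 2%N)%:R.

Definition e3_map : 'I_3 -> R * R -> R := fun i _ => e3 i.
Definition zero_grad : 'I_3 -> 'I_2 -> R * R -> R := fun _ _ _ => 0.

(* G i j = d_j n_i (weak gradient); curl n = (d_2 n_3, - d_1 n_3, d_1 n_2 - d_2 n_1) *)
Definition curl (G : 'I_3 -> 'I_2 -> R * R -> R) (i : 'I_3) (p : R * R) : R :=
  match nat_of_ord i with
  | 0%N => G (inord 2) (inord 1) p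
  | 1%N => - G (inord 2) (inord 0) p
  | _ => G (inord 1) (inord 0) p - G (inord 0) (inord 1) p
  end.

Definition Dir (G : 'I_3 -> 'I_2 -> R * R -> R) : \bar R :=
  ((2%:R)^-1%:E * \int[leb2]_p (\sum_(i < 3) \sum_(j < 2) G i j p ^+ 2)%:E)%E.

Definition Hel (n : 'I_3 -> R * R -> R) (G : 'I_3 -> 'I_2 -> R * R -> R) : \bar R :=
  (\int[leb2]_p (\sum_(i < 3) (n i p - e3 i) * curl G i p)%:E)%E.

Definition Pot (n : 'I_3 -> R * R -> R) : \bar R :=
  ((8%:R)^-1%:E * \int[leb2]_p ((\sum_(i < 3) (n i p - e3 i) ^+ 2) ^+ 2)%:E)%E.

Definition Energy (r : R) (n : 'I_3 -> R * R -> R) (G : 'I_3 -> 'I_2 -> R * R -> R)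
  : \bar R := (Dir G + r%:E * Hel n G + Pot n)%E.

Definition L2dist_e3 (n : 'I_3 -> R * R -> R) : \bar R :=
  poweR (\int[leb2]_p (\sum_(i < 3) (n i p - e3 i) ^+ 2)%:E)%E (2%:R)^-1.

End Defs.

(* Main.v *)
(** Write m = n - e3, so that |m|^2 = -2 m_3 on the sphere.  On almost every line
    the n_i are absolutely continuous, and differentiating |n|^2 = 1 gives
    d_j m_3 = - m . d_j m, hence |d_j m_3| <= |m| |d_j m| is integrable.  The
    W^{1,1} Gagliardo-Nirenberg inequality applied to m_3 then yields
    int |m|^4 <= C |m|_2^2 |grad m|_2^2.  The same chain rule bounds the helicity
    density by C |m|^2 |grad m|, so |H| <= C |m|_2 |grad m|_2^2, which is absorbed
    by the Dirichlet term when |m|_2 is small; what is left contains V > 0. *)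
Require Import Defs.
From HB Require Import structures.
From mathcomp Require Import all_boot all_order all_algebra.
From mathcomp Require Import all_classical all_reals all_analysis.
From mathcomp Require Import measurable_realfun ring lra.
Import Order.TTheory GRing.Theory Num.Theory.
Import numFieldNormedType.Exports.
Set Implicit Arguments. Unset Strict Implicit. Unset Printing Implicit Defensive.
Local Open Scope classical_set_scope.
Local Open Scope ring_scope.

(** * Smooth compactly supported test functions *)

Section SmoothTestFunctions.
Variable R : realType.
Implicit Types (f g : R -> R).

(** Cauchy-Schwarz alone gives only |H| <= C |m|_2 |grad m|_2, which is linear in the gradient and
    cannot be absorbed by the Dirichlet term when the gradient is small. The sphere constraint makes
    every coefficient of the helicity density quadratic in m, which restores the homogeneity. For
    the same reason the vertical component is singled out: m itself is only in L^2, whereas m_3,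
    being quadratic in m, is in L^1. The constraint is differentiated line by line, while weak
    derivatives are given only through test functions of the plane. Absolute continuity on almost
    every line must therefore be extracted from countably many tests, so that the exceptional null
    sets of lines can be united. This dictates explicit one-variable tests, indexed by a rational
    endpoint and a natural sharpness, and products of such tests in the plane. Slicing is always
    done along the first coordinate; the second is reached by exchanging the coordinates. *)

Definition smooth1 f := forall n x, derivable (derive1n n f) x 1.

Lemma smooth1_coind (P : (R -> R) -> Prop) :
  (forall f, P f -> (forall x, derivable f x 1) /\ P (derive1 f)) ->
  forall f, P f -> smooth1 f.
Proof.
move=> HP f Pf n; suff: P (derive1n n f) by case/HP.
by elim: n => [//|n /HP[_]]; rewrite derive1nS.
Qed.

(** The classical flat function [exp(-1/x)] with an inverse power as prefactor. The prefactors are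
    carried along because differentiation creates them: the linear span of the family is stable
    under it. *)
Definition flat_exp (n : nat) (x : R) : R :=
  if 0 < x then x^-1 ^+ n * expR (- x^-1) else 0.

Lemma flat_exp_ge0 n x : 0 <= flat_exp n x.
Proof.
rewrite /flat_exp; case: ifPn => // x0.
by rewrite mulr_ge0 ?expR_ge0 // exprn_ge0 // invr_ge0 ltW.
Qed.

(** A single term of the exponential series, [s^(n+1) / (n+1)! <= exp s] at [s = 1/x], beats the
    prefactor and leaves a factor [x]. Continuity at 0 follows for all [n] at once. *)
Lemma flat_exp_le n x : flat_exp n x <= n.+1`!%:R * `|x|.
Proof.
rewrite /flat_exp; case: ifPn => x0; last by rewrite mulr_ge0.
have s0 : 0 < x^-1 by rewrite invr_gt0.
rewrite gtr0_norm // expRN ler_pdivrMr ?expR_gt0 //.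
have := @expR_ge1Dxn R _ n (ltW s0); move/(le_trans _) => H.
have {H} : x^-1 ^+ n.+1 / n.+1`!%:R <= expR x^-1 by apply: H; lra.
rewrite ler_pdivrMr ?ltr0n ?fact_gt0 // => H.
have : x * x^-1 ^+ n.+1 <= x * (expR x^-1 * n.+1`!%:R) by rewrite ler_pM2l.
rewrite exprS (mulrA x x^-1) mulfV ?gt_eqF // mul1r => /le_trans; apply.
by rewrite le_eqVlt; apply/orP; left; apply/eqP; ring.
Qed.

Lemma flat_exp_cvg0 n : {for 0, continuous (flat_exp n)}.
Proof.
rewrite /prop_for /continuous_at {2}/flat_exp ltxx.
apply: (@squeeze_cvgr _ _ _ _ (cst 0) (fun x => n.+1`!%:R * `|x|)).
- by apply: nearW => x; rewrite flat_exp_ge0 flat_exp_le.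
- exact: cvg_cst.
- rewrite -[X in _ --> X](mulr0 (n.+1`!%:R)).
  apply: cvgM; first exact: cvg_cst.
  by rewrite -[X in _ --> X](@normr0 _ R^o); exact: norm_continuous.
Qed.

Lemma is_derive_flat_exp n (x : R) :
  is_derive x 1 (flat_exp n) (flat_exp n.+2 x - n%:R * flat_exp n.+1 x).
Proof.
have [x0|x0|->] := ltgtP x 0.
- rewrite /flat_exp !ltNge (ltW x0) /= mulr0 subr0.
  apply: (@near_eq_is_derive _ _ _ (cst 0)).
  near=> y; rewrite ltNge ifF //; apply/negbTE; rewrite negbK ltW //.
  by near: y; exact: lt_nbhsl.
- rewrite /flat_exp x0.
  apply: (@near_eq_is_derive _ _ _ (fun y : R => y^-1 ^+ n * expR (- y^-1))).
    near=> y; rewrite ifT //; near: y; exact: lt_nbhsr.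
  have dV : is_derive x 1 (fun y : R => y^-1) (- x ^- 2 *: 1).
    by apply: is_deriveV; rewrite gt_eqF.
  have dE : is_derive x 1 (fun y : R => expR (- y^-1)) (expR (- x^-1) * (- (- x ^- 2 *: 1))).
    exact: (@is_derive1_comp _ expR (fun y => - y^-1)).
  have dX : is_derive x 1 (fun y : R => y^-1 ^+ n) ((n%:R * x^-1 ^+ n.-1) *: (- x ^- 2 *: 1)).
    by have := is_deriveX n dV; rewrite exprfctE.
  apply: (@is_derive_eq _ _ _ _ _ _ _ _ (is_deriveM dX dE)).
  rewrite /GRing.scale /= -exprVn.
  case: n dX => [|n] _ /=; rewrite ?exprS; ring.
- rewrite {2 3}/flat_exp ltxx mulr0 subr0.
  (* At 0 the difference quotient of [flat_exp n] is exactly [flat_exp n.+1], so the derivative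
     there reduces to continuity of the next function. *)
  apply/is_derive1_caratheodory; exists (flat_exp n.+1); split.
  + move=> z; rewrite subr0 {2}/flat_exp ltxx subr0 /flat_exp; case: ifPn => [z0|]; last by rewrite mul0r.
    by rewrite exprS; field; rewrite gt_eqF.
  + exact: flat_exp_cvg0.
  + by rewrite /flat_exp ltxx.
Unshelve. all: by end_near. Qed.

(* A class closed under differentiation, so smoothness needs only first derivatives. *)
Inductive bumpy : (R -> R) -> Prop :=
| bumpy_base c n m a b a' b' :
    bumpy (fun x => c * (flat_exp n (a * x + b) * flat_exp m (a' * x + b')))
| bumpy_add f g : bumpy f -> bumpy g -> bumpy (fun x => f x + g x).

Lemma bumpy_scale c f : bumpy f -> bumpy (fun x => c * f x).
Proof.
move=> bf; elim: bf c => [d n m a b a' b' c|g h _ IH1 _ IH2 c].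
  under eq_fun do rewrite mulrA; exact: bumpy_base.
under eq_fun do rewrite mulrDr; exact: bumpy_add.
Qed.

Lemma bumpy_is_derive f : bumpy f ->
  exists f', bumpy f' /\ forall x : R, is_derive x 1 f (f' x).
Proof.
elim=> [c n m a b a' b'|g h _ [g' [bg dg]] _ [h' [bh dh]]].
  have dA k d e (x : R) : is_derive x 1 (fun x => flat_exp k (d * x + e))
      ((flat_exp k.+2 (d * x + e) - k%:R * flat_exp k.+1 (d * x + e)) * d).
    apply: (@is_derive1_comp _ (flat_exp k) (fun x => d * x + e)).
      exact: is_derive_flat_exp.
    have dd : is_derive x 1 (fun x => d * x) (d *: 1) by exact: is_deriveZ.
    apply: (@is_derive_eq _ _ _ _ _ _ _ _ (is_deriveD dd (is_derive_cst e x 1))).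
    by rewrite addr0 /GRing.scale /= mulr1.
  pose B d k l x := d * (flat_exp k (a * x + b) * flat_exp l (a' * x + b')).
  exists (fun x => (B (c * a) n.+2 m x + B (- (c * a * n%:R)) n.+1 m x) +
    (B (c * a') n m.+2 x + B (- (c * a' * m%:R)) n m.+1 x)); split.
    by do 2!apply: bumpy_add; exact: bumpy_base.
  move=> x; have dM := is_deriveM (dA n a b x) (dA m a' b' x).
  apply: (@is_derive_eq _ _ _ _ _ _ _ _ (is_deriveZ c dM)).
  rewrite /B /GRing.scale /=; ring.
exists (fun x => g' x + h' x); split; first exact: bumpy_add.
by move=> x; exact: is_deriveD.
Qed.

Lemma bumpy_derivable f x : bumpy f -> derivable f x 1.
Proof. by move=> /bumpy_is_derive[f' [_ /(_ x)[]]]. Qed.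

Lemma bumpy_continuous f : bumpy f -> continuous f.
Proof.
by move=> bf x; apply/differentiable_continuous/derivable1_diffP/bumpy_derivable.
Qed.

Lemma bumpy_derive1 f : bumpy f -> bumpy (derive1 f).
Proof.
move=> /bumpy_is_derive[f' [bf' df]]; suff -> : derive1 f = f' by [].
by apply/funext => x; rewrite derive1E; exact: derive_val.
Qed.

Lemma bumpy_smooth1 f : bumpy f -> smooth1 f.
Proof.
apply: smooth1_coind => g bg; split; last exact: bumpy_derive1.
by move=> x; exact: bumpy_derivable.
Qed.

(** Smooth bumps vanishing outside []a, b[] which tend to its indicator as [k] grows; the factor
    [k.+1] keeps them positive inside already for [k = 0]. *)
Definition plateau (a b : R) (k : nat) (x : R) : R :=
  flat_exp 0 (k.+1%:R * (x - a)) * flat_exp 0 (k.+1%:R * (b - x)).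

Lemma plateau_bumpy a b k : bumpy (plateau a b k).
Proof.
have -> : plateau a b k = fun x => 1 *
   (flat_exp 0 (k.+1%:R * x + - (k.+1%:R * a)) *
    flat_exp 0 ((- k.+1%:R) * x + k.+1%:R * b)).
  by apply/funext => x; rewrite mul1r /plateau; congr (flat_exp _ _ * flat_exp _ _); ring.
exact: bumpy_base.
Qed.

Lemma flat_exp0_le1 x : flat_exp 0 x <= 1.
Proof.
rewrite /flat_exp; case: ifPn => // x0.
by rewrite expr0 mul1r -expR0 ler_expR oppr_le0 invr_ge0 ltW.
Qed.

Lemma plateau_ge0 a b k x : 0 <= plateau a b k x.
Proof. by rewrite mulr_ge0 ?flat_exp_ge0. Qed.

Lemma plateau_le1 a b k x : plateau a b k x <= 1.
Proof. by rewrite mulr_ile1 ?flat_exp_ge0 ?flat_exp0_le1. Qed.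

Lemma plateau_gt0 a b k x : a < x < b -> 0 < plateau a b k x.
Proof.
have H d : 0 < d -> 0 < flat_exp 0 (k.+1%:R * d).
  by move=> d0; rewrite /flat_exp mulr_gt0 ?ltr0n // mul1r expR_gt0.
by move=> /andP[ax xb]; rewrite /plateau mulr_gt0 // H // subr_gt0.
Qed.

Lemma plateau_out a b k x : ~~ (a < x < b) -> plateau a b k x = 0.
Proof.
rewrite negb_and -!leNgt => /orP[xa|bx]; rewrite /plateau /flat_exp.
  by rewrite ltNge mulr_ge0_le0 ?subr_le0 ?ler0n //= mul0r.
by rewrite [X in _ * X]ifF ?mulr0 //; apply/negbTE; rewrite -leNgt mulr_ge0_le0 ?subr_le0 ?ler0n.
Qed.

Lemma plateau_cvg a b x : plateau a b k x @[k --> \oo] --> (\1_(`]a, b[%classic) x : R).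
Proof.
rewrite indicE; case: (boolP (a < x < b)) => axb; last first.
  rewrite memNset; last by rewrite /= in_itv; exact/negP.
  by under eq_fun do rewrite plateau_out //; exact: cvg_cst.
rewrite mem_set; last by rewrite /= in_itv.
have H (d : R) : 0 < d -> flat_exp 0 (k.+1%:R * d) @[k --> \oo] --> (1 : R).
  move=> d0; rewrite (_ : (fun k => _) = (fun k : nat => expR (- (k.+1%:R^-1 * d^-1)))); last first.
    apply/funext => k; rewrite /flat_exp mulr_gt0 ?ltr0n // expr0 mul1r.
    by rewrite invfM.
  rewrite [X in _ --> X](_ : _ = expR (- (0 * d^-1))); last first.
    by rewrite mul0r oppr0 expR0.
  apply: continuous_cvg; first exact: continuous_expR.
  apply: cvgN; apply: cvgM; first exact: cvg_harmonic.
  exact: cvg_cst.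
move/andP: axb => [ax xb]; rewrite -(mulr1 (true%:R)).
by apply: cvgM; apply: H; rewrite subr_gt0.
Qed.

(** * One-variable tests and their tensor products *)

Definition test1 f := smooth1 f /\ exists a b, forall x, ~~ (a < x < b) -> f x = 0.

Lemma smooth1_continuous n f : smooth1 f -> continuous (derive1n n f).
Proof.
by move=> sf x; apply/differentiable_continuous/derivable1_diffP/sf.
Qed.

Lemma bumpy_test1 a b f : bumpy f -> (forall x, ~~ (a < x < b) -> f x = 0) -> test1 f.
Proof. by move=> bf f0; split; [exact: bumpy_smooth1|exists a, b]. Qed.

Lemma is_derive_mulc f (c x : R) : derivable f x 1 ->
  is_derive x 1 (fun t => f t * c) (derive1 f x * c).
Proof.
move=> df; have := is_deriveZ c (derivableP df).
rewrite -derive1E /GRing.scale /= mulrC => H.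
by under eq_fun do rewrite mulrC.
Qed.

Lemma is_derive_cmul f (c x : R) : derivable f x 1 ->
  is_derive x 1 (fun t => c * f t) (c * derive1 f x).
Proof.
by move=> df; under eq_fun do rewrite mulrC; rewrite mulrC; exact: is_derive_mulc.
Qed.

Lemma partial_tensor j f g (df : forall x, derivable f x 1)
    (dg : forall x, derivable g x 1) :
  partial j (fun p => f p.1 * g p.2) =
  if (j == 0 :> nat) then fun p => derive1 f p.1 * g p.2
  else fun p => f p.1 * derive1 g p.2.
Proof.
rewrite /partial; case: ifP => _; apply/funext => -[x y] /=; rewrite derive1E.
  by rewrite (@derive_val _ _ _ _ _ _ _ (is_derive_mulc (g y) (df x))).
by rewrite (@derive_val _ _ _ _ _ _ _ (is_derive_cmul (f x) (dg y))).
Qed.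

Lemma partial_derivable_tensor j f g p (df : forall x, derivable f x 1)
    (dg : forall x, derivable g x 1) :
  partial_derivable j (fun p => f p.1 * g p.2) p.
Proof.
rewrite /partial_derivable; case: ifP => _ /=.
  by case: (is_derive_mulc (g p.2) (df p.1)).
by case: (is_derive_cmul (f p.1) (dg p.2)).
Qed.

Lemma iter_partial_tensor s f g : smooth1 f -> smooth1 g ->
  exists m n, iter_partial s (fun p => f p.1 * g p.2) =
    fun p => derive1n m f p.1 * derive1n n g p.2.
Proof.
move=> sf sg; elim: s => [|j s [m [n IH]]]; first by exists 0%N, 0%N.
rewrite /iter_partial /= -/(iter_partial s _) IH partial_tensor //.
case: ifP => _; first by exists m.+1, n; rewrite derive1nS.
by exists m, n.+1; rewrite derive1nS.
Qed.

(** Partial derivatives map tensor products to tensor products, so smoothness in the plane reduces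
    to smoothness of the two factors; the support lies in a closed rectangle. *)
Lemma tensor_test_fun f g : test1 f -> test1 g -> test_fun (fun p => f p.1 * g p.2).
Proof.
move=> [sf [a [b f0]]] [sg [c [d g0]]]; split.
  move=> s; have [m [n ->]] := iter_partial_tensor s sf sg; split.
    move=> p; apply: cvgM.
      apply: (@continuous_comp _ _ _ fst); first exact: cvg_fst.
      exact: smooth1_continuous.
    apply: (@continuous_comp _ _ _ snd); first exact: cvg_snd.
    exact: smooth1_continuous.
  by move=> j p; exact: partial_derivable_tensor.
have cK : compact (`[a, b]%classic `*` `[c, d]%classic : set (R * R)).
  by apply: compact_setX; exact: segment_compact.
apply: (subclosed_compact _ cK); first exact: closed_closure.
have KE := (closure_id _).1 (compact_closed (@norm_hausdorff _ _) cK).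
rewrite [X in _ `<=` X]KE.
apply: closure_subset => -[x y] /= xy0; rewrite !in_itv /=.
have [ax|/f0 E] := boolP (a < x < b); last by rewrite E mul0r eqxx in xy0.
have [cy|/g0 E] := boolP (c < y < d); last by rewrite E mulr0 eqxx in xy0.
by move: ax cy => /andP[/ltW-> /ltW->] /andP[/ltW-> /ltW->].
Qed.

Local Notation mu := (@lebesgue_measure R).

Lemma bumpy_integrable a b f : bumpy f -> (forall x, ~~ (a < x < b) -> f x = 0) ->
  mu.-integrable setT (EFin \o f).
Proof.
move=> bf f0; have -> : f = f \_ `[a, b].
  apply/funext => x; rewrite patchE; case: ifPn => // /negP xab.
  apply: f0; apply: contra_notN xab => /andP[ax xb].
  by rewrite inE /= in_itv /= !ltW.
rewrite -restrict_EFin; apply/(integrable_mkcond _ _).1 => //.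
apply: continuous_compact_integrable; first exact: segment_compact.
by apply: continuous_subspaceT; exact: bumpy_continuous.
Qed.

(** Zero mean is what makes the primitive vanish again beyond [b]. Thus any bumpy function of mean
    zero supported in an interval is the derivative of an admissible test. *)
Lemma bumpy_antiderivative a b f : bumpy f -> (forall x, ~~ (a < x < b) -> f x = 0) ->
  (\int[mu]_x f x = 0)%R ->
  let F t := (\int[mu]_(x in `]-oo, t]) f x)%R in
  [/\ test1 F, derive1 F = f & forall x, ~~ (a < x < b) -> F x = 0].
Proof.
move=> bf f0 int0 F; have fi := bumpy_integrable bf f0.
have dF x : derivable F x 1 /\ derive1 F x = f x.
  apply: (@continuous_FTC1 _ f -oo%O x (x + 1)); rewrite ?ltrDl //.
    exact: integrableS fi.
  by rewrite ltNyr.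
  exact: bumpy_continuous.
have F'E : derive1 F = f by apply/funext => x; case: (dF x).
have F0 x : ~~ (a < x < b) -> F x = 0.
  rewrite /F negb_and -!leNgt => /orP[xa|bx].
    rewrite (@eq_Rintegral _ _ _ _ _ (cst 0)); first by rewrite Rintegral_cst // mul0r.
    move=> y; rewrite inE /= in_itv /= => yx; apply: f0.
    by rewrite negb_and -leNgt (le_trans yx).
  rewrite Rintegral_mkcond -[RHS]int0; congr Rintegral; apply/funext => y.
  rewrite patchE; case: ifPn => // /negP yx; rewrite f0 // negb_and -!leNgt.
  apply/orP; right; apply: (le_trans bx); rewrite leNgt; apply: contra_notN yx => yx.
  by rewrite inE /= in_itv /= ltW.
split => //; split; last by exists a, b.
move=> [|n] x; first by case: (dF x).
have -> : derive1n n.+1 F = derive1n n f by rewrite /derive1n iterSr F'E.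
exact: bumpy_smooth1.
Qed.

End SmoothTestFunctions.

(** * Real-valued Lebesgue integrals *)

Section RealIntegrals.
Context d (T : measurableType d) (R : realType) (m : {measure set T -> \bar R}).
Implicit Types f g h : T -> R.
Local Notation intg f := (m.-integrable setT (EFin \o f)).

Lemma aeS (P Q : T -> Prop) : (forall x, P x -> Q x) ->
  {ae m, forall x, P x} -> {ae m, forall x, Q x}.
Proof. by move=> PQ; apply: negligibleS => x; apply: contra_not; exact: PQ. Qed.

Lemma aeI (P Q : T -> Prop) : {ae m, forall x, P x} -> {ae m, forall x, Q x} ->
  {ae m, forall x, P x /\ Q x}.
Proof.
move=> aP aQ; apply: negligibleS (negligibleU aP aQ) => x /= nPQ.
by apply: contrapT => /not_orP[/contrapT Px /contrapT Qx]; exact: nPQ.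
Qed.

Lemma EFin_Rintegral f : intg f -> (\int[m]_x (f x)%:E = (\int[m]_x f x)%:E)%E.
Proof. by move=> /integrable_fin_num -/(_ measurableT) fin; rewrite fineK. Qed.

Lemma intg_measurable f : intg f -> measurable_fun setT f.
Proof. by move=> /integrableP[/measurable_EFinP]. Qed.

Lemma Rintegral0_ae h : intg h -> (forall x, 0 <= h x) -> \int[m]_x h x = 0 ->
  {ae m, forall x, h x = 0}.
Proof.
move=> hi h0 ih; have mh := intg_measurable hi.
have [+ _] := @ae_eq_integral_abs _ _ _ m setT measurableT (EFin \o h)
  ((measurable_EFinP _ _).2 mh).
have -> : (\int[m]_x `|(EFin \o h) x| = 0)%E.
  under eq_integral do rewrite /= ger0_norm //.
  by rewrite EFin_Rintegral ?ih.
by move=> /(_ erefl); apply: aeS => x /(_ I)[].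
Qed.

Lemma intgD f g : intg f -> intg g -> intg (fun x => f x + g x).
Proof. by move=> fi gi; have := integrableD measurableT fi gi. Qed.

Lemma intgB f g : intg f -> intg g -> intg (fun x => f x - g x).
Proof. by move=> fi gi; have := integrableB measurableT fi gi. Qed.

Lemma intgZ c f : intg f -> intg (fun x => c * f x).
Proof. by move=> fi; have := integrableZl measurableT c fi. Qed.

Lemma le_intg f g : measurable_fun setT f -> (forall x, `|f x| <= `|g x|) ->
  intg g -> intg f.
Proof.
move=> mf fg; apply: le_integrable => //; first exact/measurable_EFinP.
by move=> x _; rewrite /= lee_fin.
Qed.

Lemma ae_le_intg f g : measurable_fun setT f ->
  {ae m, forall x, `|f x| <= `|g x|} -> intg g -> intg f.
Proof.
move=> mf fg gi; apply/integrableP; split; first exact/measurable_EFinP.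
have [/measurable_EFinP mg] := integrableP _ _ _ gi; apply: le_lt_trans.
apply: ae_ge0_le_integral => //.
- by apply: measurableT_comp => //; exact/measurable_EFinP.
- by apply: measurableT_comp => //; exact/measurable_EFinP.
- by apply: aeS fg => x fgx _; rewrite /= lee_fin.
Qed.

Lemma intgMb M f h : intg f -> measurable_fun setT h -> (forall x, `|h x| <= M) ->
  intg (fun x => f x * h x).
Proof.
move=> fi mh hM; apply: (@le_intg _ (fun x => M * f x)); last exact: intgZ.
  by apply: measurable_funM => //; exact: intg_measurable.
move=> x; rewrite !normrM mulrC ler_wpM2r //.
by rewrite (le_trans (hM x)) // ler_norm.
Qed.

Lemma ae_le_Rintegral f g : intg f -> intg g ->
  {ae m, forall x, f x <= g x} -> \int[m]_x f x <= \int[m]_x g x.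
Proof.
move=> fi gi fg; rewrite -subr_ge0 -RintegralB //.
have mfg : measurable_fun setT (fun x => g x - f x).
  by apply: measurable_funB; exact: intg_measurable.
rewrite (_ : \int[m]_x _ = \int[m]_x `|g x - f x|); first exact: Rintegral_ge0.
congr fine; apply: ae_eq_integral => //.
- exact/measurable_EFinP.
- by apply/measurable_EFinP; exact: measurableT_comp.
- by apply: aeS fg => x fgx _ /=; rewrite ger0_norm // subr_ge0.
Qed.

Lemma dominated_Rintegral (u : nat -> T -> R) f g :
  (forall k, measurable_fun setT (u k)) -> intg g ->
  (forall k x, `|u k x| <= g x) -> (forall x, u k x @[k --> \oo] --> f x) ->
  \int[m]_x u k x @[k --> \oo] --> \int[m]_x f x.
Proof.
move=> mu gi ug uf.
have mf : measurable_fun setT f.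
  apply: (@measurable_fun_cvg _ _ _ _ u) => // x _; exact: uf.
have mE h : measurable_fun setT h -> measurable_fun setT (EFin \o h).
  by move=> mh; exact/measurable_EFinP.
have [fi _ cvgi] : [/\ m.-integrable setT (EFin \o f),
    [sequence \int[m]_(x in setT) (`|(u k x)%:E - (f x)%:E|)]_k @ \oo --> 0 &
    [sequence \int[m]_(x in setT) ((u k x)%:E)]_k @ \oo --> \int[m]_x (f x)%:E]%E.
  apply: (@dominated_convergence _ _ _ m setT measurableT
    (fun k x => (u k x)%:E) (EFin \o f) (EFin \o g)) => //.
  - by move=> k; exact: mE.
  - exact: mE.
  - by apply: aeW => x _; apply: cvg_EFin; [exact: nearW|exact: uf].
  - by apply: aeW => x k _; rewrite /= lee_fin.
apply: (@fine_cvg _ _ _ _ (fun k => \int[m]_x (u k x)%:E)%E).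
by rewrite -EFin_Rintegral.
Qed.

End RealIntegrals.

(** * Weak derivatives on the line *)

Section OneDimension.
Variable R : realType.
Local Notation mu := (@lebesgue_measure R).
Local Notation mu2 := (@lebesgue_measure R \x @lebesgue_measure R)%E.
Local Notation intg f := (mu.-integrable setT (EFin \o f)).
Implicit Types f g h : R -> R.

Definition primitive h (x : R) : R := (\int[mu]_(t in `]-oo, x]) h t)%R.

Lemma primitiveB h x y : intg h -> x <= y ->
  primitive h y - primitive h x = (\int[mu]_(t in `]x, y]) h t)%R.
Proof.
move=> hi xy; rewrite /primitive Rintegral_itvB //.
exact: integrableS hi.
Qed.

Lemma primitive_continuous h : intg h -> continuous (primitive h).
Proof.
move=> hi x; apply/cvgrPdist_lt => e e0.
have [d [d0 hd]] := integral_normr_continuous hi e0.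
have key y z : y <= z -> z - y < d -> `|primitive h z - primitive h y| < e.
  move=> yz zyd; rewrite primitiveB //.
  have hyz : mu.-integrable `]y, z] (EFin \o h) by exact: integrableS hi.
  apply: le_lt_trans (le_normr_Rintegral _ hyz) _ => //.
  have myz : (lebesgue_measure (`]y, z]%classic : set R) < d%:E)%E.
    by rewrite lebesgue_measure_itv /= lte_fin; case: ifP => // _; rewrite -EFinD lte_fin.
  exact: hd.
near=> y; have xyd : `|x - y| < d by near: y; exact: cvgr_dist_lt.
have [xy|yx] := leP x y.
  by rewrite distrC key // -(ger0_norm (_ : 0 <= y - x)) ?subr_ge0 // distrC.
by rewrite key ?ltW // -(ger0_norm (_ : 0 <= x - y)) // subr_ge0 ltW.
Unshelve. all: by end_near. Qed.

Lemma primitive_ae_derive h : intg h ->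
  {ae mu, forall x, derivable (primitive h) x 1 /\ derive1 (primitive h) x = h x}.
Proof.
move=> hi; apply: FTC1Ny; first by move=> y; exact: integrableS hi.
apply: open_integrable_locally => //; exact: openT.
Qed.

(** By Lebesgue differentiation. This is the device that turns vanishing integrals over intervals
    into vanishing almost everywhere, both on a line and, later, across the family of lines. *)
Lemma primitive_cst_ae0 h a b c : intg h ->
  (forall x, a < x < b -> primitive h x = c) ->
  {ae mu, forall x, a < x < b -> h x = 0}.
Proof.
move=> hi hc; have := primitive_ae_derive hi.
apply: aeS => x [_ <-] axb.
rewrite derive1E; transitivity ('D_1 (cst c : R -> R) x); last exact: derive_cst.
case/andP: axb => ax xb; apply: near_eq_derive; near=> y; apply: hc.
by apply/andP; split; near: y; [exact: lt_nbhsr|exact: lt_nbhsl].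
Unshelve. all: by end_near. Qed.

Lemma continuous_dense_eq h (A : set R) a b c : continuous h -> dense A ->
  (forall x, A x -> a < x < b -> h x = c) -> forall x, a < x < b -> h x = c.
Proof.
move=> ch dA hc x axb; apply: contrapT => /eqP hx.
pose U := [set y | h y != c] `&` `]a, b[%classic.
have [y [[]]] : U `&` A !=set0.
  apply: dA; first by exists x; split; rewrite /= ?in_itv.
  apply: openI; last exact: interval_open.
  by apply: (open_comp (D := [set z | z != c])) => [z _|]; [exact: ch|exact: open_neq].
by move=> /eqP hy; rewrite /= in_itv => yab /hc /(_ yab)/hy.
Qed.

Lemma ae_dense (P : set R) : {ae mu, forall x, P x} -> dense P.
Proof.
move=> aeP U [x Ux] oU; apply/set0P/negP => /eqP UP0.
have [e /= e0 eU] := (open_nbhs_nbhs (conj oU Ux) : nbhs x U).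
have nB : mu.-negligible (ball x e).
  apply: negligibleS aeP => y /eU Uy Py.
  by have : (U `&` P) y by []; rewrite UP0.
have : (lebesgue_measure (ball x e) = 0)%E.
  by apply: (measure_negligible _ nB); exact: measurable_ball.
rewrite lebesgue_measure_ball ?ltW // => /eqP.
by rewrite eqe mulrn_eq0 /= gt_eqF.
Qed.

Lemma primitive_measurable h : intg h -> measurable_fun setT (primitive h).
Proof. by move=> /primitive_continuous; exact: continuous_measurable_fun. Qed.

Lemma primitive_bound h x : intg h -> `|primitive h x| <= \int[mu]_x `|h x|.
Proof.
move=> hi; rewrite /primitive.
have hn : intg (fun y => `|h y|) by exact: integrable_norm hi.
apply: (le_trans (le_normr_Rintegral _ _)) => //; first exact: integrableS hi.
rewrite Rintegral_mkcond; apply: le_Rintegral => //.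
- rewrite -restrict_EFin; apply/(integrable_mkcond _ _).1 => //.
  exact: integrableS hn.
- by move=> t _; rewrite patchE; case: ifP => // _; exact: normr_ge0.
Qed.

Lemma tensor_intg f g : intg f -> intg g ->
  mu2.-integrable setT (EFin \o (fun p => f p.1 * g p.2)).
Proof.
move=> fi gi; apply/integrable12ltyP.
  apply/measurable_EFinP; apply: measurable_funM.
    by apply: measurableT_comp; [exact: intg_measurable fi|exact: measurable_fst].
  by apply: measurableT_comp; [exact: intg_measurable gi|exact: measurable_snd].
have fi' := integrable_norm fi; have gi' := integrable_norm gi.
under eq_integral => x _.
  under eq_integral do rewrite /= normrM EFinM.
  rewrite integralZl // EFin_Rintegral //.
  over.
rewrite /= -[ltLHS]/(\int[mu]_x ((`|f x|)%:E * _))%E integralZr //.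
by rewrite EFin_Rintegral // -EFinM ltry.
Qed.

(** Fubini for [f x * g y] on the half-plane [y <= x]. One order of integration produces
    [primitive g x]; the other produces the integral of [f] over [[y, +oo[], which is
    [- primitive f y] because [f] has mean zero. *)
Lemma primitive_ibp f g : intg f -> intg g -> (\int[mu]_x f x)%R = 0 ->
  (\int[mu]_x (primitive g x * f x) = - \int[mu]_x (g x * primitive f x))%R.
Proof.
move=> fi gi f0.
pose K p := f p.1 * g p.2 * (p.2 <= p.1)%R%:R.
have mle : measurable_fun setT (fun p : R * R => (p.2 <= p.1)%R%:R : R).
  have -> : (fun p : R * R => (p.2 <= p.1)%R%:R : R) = \1_[set p : R * R | p.2 <= p.1].
    apply/funext => p; rewrite indicE; case: (boolP (p.2 <= p.1)) => yx.
      by rewrite mem_set.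
    by rewrite memNset //=; exact/negP.
  apply: measurable_indic.
  have -> : [set p : R * R | p.2 <= p.1] = setT `&` (fun p : R * R => p.2 <= p.1) @^-1` [set true].
    by rewrite setTI; apply/seteqP; split => p /=.
  have mb : measurable_fun setT (fun p : R * R => p.2 <= p.1).
    by apply: measurable_fun_ler; [exact: measurable_snd|exact: measurable_fst].
  exact: mb.
have Ki : mu2.-integrable setT (EFin \o K).
  apply: (@intgMb _ _ _ _ 1 _ _ (tensor_intg fi gi)) => //.
  by move=> p; case: (p.2 <= p.1); rewrite ?normr1 ?normr0.
have := Fubini Ki.
have -> : (\int[mu]_x \int[mu]_y (EFin \o K) (x, y) =
           \int[mu]_x (primitive g x * f x)%:E)%E.
  apply: eq_integral => x _.
  transitivity (\int[mu]_y ((f x)%:E * ((g \_ `]-oo, x]) y)%:E))%E.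
    apply: eq_integral => y _; rewrite /K /= -EFinM patchE; congr EFin.
    rewrite -mulrA; congr (_ * _).
    case: (leP y x) => yx.
      by rewrite mulr1 mem_set //= in_itv.
    by rewrite mulr0 memNset //= in_itv /= leNgt yx.
  have gi' : intg (g \_ `]-oo, x]).
    rewrite -restrict_EFin; apply/(integrable_mkcond _ _).1 => //; exact: integrableS gi.
  by rewrite integralZl // EFin_Rintegral // -Rintegral_mkcond -EFinM mulrC.
have -> : (\int[mu]_y \int[mu]_x (EFin \o K) (x, y) =
           \int[mu]_x (- (g x * primitive f x))%:E)%E.
  apply: eq_integral => y _.
  transitivity (\int[mu]_x ((g y)%:E * ((f \_ `[y, +oo[) x)%:E))%E.
    apply: eq_integral => x _; rewrite /K /= -EFinM patchE; congr EFin.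
    rewrite mulrAC mulrC; congr (_ * _).
    case: (leP y x) => yx.
      by rewrite mulr1 mem_set //= in_itv /= yx.
    by rewrite mulr0 memNset //= in_itv /= leNgt yx.
  have fi' : intg (f \_ `[y, +oo[).
    rewrite -restrict_EFin; apply/(integrable_mkcond _ _).1 => //; exact: integrableS fi.
  rewrite integralZl // EFin_Rintegral // -Rintegral_mkcond -EFinM -mulrN; congr (_ * _)%:E.
  have fT : mu.-integrable `]-oo, +oo[ (EFin \o f) by rewrite set_itvNyy.
  have := Rintegral_itvB (x := y) fT; rewrite set_itvNyy f0 sub0r => ->//.
  by rewrite Rintegral_itv_obnd_cbnd //; exact: integrableS fi.
have i2 : intg (fun x => g x * primitive f x).
  apply: (intgMb gi (primitive_measurable fi)) => x; exact: primitive_bound.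
move=> /(congr1 fine); rewrite -!/(Rintegral _ _ _) => ->.
under eq_Rintegral do rewrite -mulN1r.
by rewrite RintegralZl // mulN1r.
Qed.


(** * The du Bois-Reymond lemma on an interval, with countably many tests *)

Variables a b : R.
Hypothesis ab : a < b.

Definition test_mass (q : R) k : R :=
  (\int[mu]_x plateau a q k x) / (\int[mu]_x plateau a b 0 x).

(** The multiple of the fixed plateau on []a, b[] is subtracted to reach mean zero, so that the
    primitive [test] is compactly supported. With [q] rational and [k] natural the family is
    countable. *)
Definition dtest q k x := plateau a q k x - test_mass q k * plateau a b 0 x.

Definition test q k := primitive (dtest q k).

Lemma plateau_intg (c d : R) k : intg (plateau c d k).
Proof. exact: (bumpy_integrable (plateau_bumpy c d k) (@plateau_out _ c d k)). Qed.

Lemma plateau_mass_neq0 : \int[mu]_x plateau a b 0 x != 0.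
Proof.
apply/eqP => /(Rintegral0_ae (plateau_intg a b 0) (plateau_ge0 a b 0))/ae_dense D.
have [x [/= +]] : `]a, b[%classic `&` [set x | plateau a b 0 x = 0] !=set0.
  apply: D; last exact: interval_open.
  by exists ((a + b) / 2); rewrite /= in_itv /= !midf_lt.
by rewrite in_itv /= => /(plateau_gt0 0) /[swap] ->; rewrite ltxx.
Qed.

Lemma dtest_bumpy q k : bumpy (dtest q k).
Proof.
rewrite /dtest; under eq_fun do rewrite -mulNr.
by apply: bumpy_add; [|apply: bumpy_scale]; exact: plateau_bumpy.
Qed.

Lemma dtest_out q k x : q < b -> ~~ (a < x < b) -> dtest q k x = 0.
Proof.
move=> qb xab; rewrite /dtest !plateau_out ?mulr0 ?subr0 //.
by apply: contra xab => /andP[-> /= xq]; exact: lt_trans qb.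
Qed.

Lemma dtest_intg q k : intg (dtest q k).
Proof. by apply: intgB; [|apply: intgZ]; exact: plateau_intg. Qed.

Lemma dtest_int0 q k : \int[mu]_x dtest q k x = 0.
Proof.
rewrite RintegralB //; [|exact: plateau_intg|by apply: intgZ; exact: plateau_intg].
rewrite RintegralZl //; last exact: plateau_intg.
by rewrite divfK ?subrr // plateau_mass_neq0.
Qed.

Lemma testP q k : q < b ->
  [/\ test1 (test q k), derive1 (test q k) = dtest q k &
      forall x, ~~ (a < x < b) -> test q k x = 0].
Proof.
move=> qb; apply: bumpy_antiderivative; first exact: dtest_bumpy.
  by move=> x; exact: dtest_out.
exact: dtest_int0.
Qed.

Lemma dtest_bound q k : exists M, forall x, `|dtest q k x| <= M.
Proof.
exists (1 + `|test_mass q k|) => x; rewrite /dtest (le_trans (ler_normB _ _)) //.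
have p c d j : `|plateau c d j x| <= 1 by rewrite ger0_norm ?plateau_ge0 ?plateau_le1.
by rewrite lerD // (normrM (test_mass q k)) ler_piMr.
Qed.

(** Put [u = f - primitive g]. Integration by parts makes [u] orthogonal to every [dtest], hence
    [u - C] orthogonal to every plateau. Letting [k] grow, the integral of [u - C] from [a] to each
    rational [q] vanishes; by continuity of the primitive this holds at every point of []a, b[], so
    [u = C] almost everywhere there. *)
Lemma du_bois_reymond f g : intg f -> intg g ->
  (forall (q : rat) k, a < ratr q < b ->
     \int[mu]_x (f x * dtest (ratr q) k x + g x * test (ratr q) k x) = 0) ->
  exists C, {ae mu, forall x, a < x < b -> f x = C + primitive g x}.
Proof.
move=> fi gi H.
pose u x := f x - primitive g x.
have ub h M : intg h -> (forall x, `|h x| <= M) -> intg (fun x => u x * h x).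
  move=> hi hM; rewrite /u; under eq_fun do rewrite mulrBl.
  apply: intgB; first exact: (intgMb fi (intg_measurable hi) hM).
  under eq_fun do rewrite mulrC.
  apply: (intgMb hi (primitive_measurable gi)) => x; exact: primitive_bound.
have plateaub c d k x : `|plateau c d k x : R| <= 1.
  by rewrite ger0_norm ?plateau_ge0 // plateau_le1.
have ubi c d k : intg (fun x => u x * plateau c d k x).
  exact: (ub _ 1 (plateau_intg c d k)).
(* The mean of [u] weighted by the fixed plateau: orthogonality to [dtest] forces this value of the
   constant. *)
pose C := (\int[mu]_x (u x * plateau a b 0 x)) / (\int[mu]_x plateau a b 0 x).
have uq (q : rat) k : a < ratr q < b ->
    \int[mu]_x ((u x - C) * plateau a (ratr q) k x) = 0.
  move=> aqb; have [aq qb] := andP aqb; have [M dM] := dtest_bound (ratr q) k.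
  have u0 : \int[mu]_x (u x * dtest (ratr q) k x) = 0.
    under eq_Rintegral do rewrite mulrBl.
    have i1 : intg (fun x => f x * dtest (ratr q) k x).
      exact: (intgMb fi (intg_measurable (dtest_intg _ _)) dM).
    have i2 : intg (fun x => g x * test (ratr q) k x).
      apply: (intgMb gi (primitive_measurable (dtest_intg _ _))) => x.
      exact: primitive_bound (dtest_intg _ _).
    have i3 : intg (fun x => primitive g x * dtest (ratr q) k x).
      under eq_fun do rewrite mulrC.
      apply: (intgMb (dtest_intg _ _) (primitive_measurable gi)) => x.
      exact: primitive_bound.
    rewrite RintegralB // primitive_ibp //; [|exact: dtest_intg|exact: dtest_int0].
    by rewrite opprK -RintegralD // H.
  have Q : \int[mu]_x (u x * plateau a (ratr q) k x) = C * \int[mu]_x plateau a (ratr q) k x.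
    apply/eqP; rewrite -subr_eq0 -[X in _ == X]u0; apply/eqP.
    rewrite /dtest; under [RHS]eq_Rintegral do rewrite mulrBr (mulrCA _ (test_mass _ _)).
    rewrite RintegralB //; last by apply: intgZ; exact: ubi.
    by rewrite RintegralZl // /C /test_mass; field; exact: plateau_mass_neq0.
  under eq_Rintegral do rewrite mulrBl.
  rewrite RintegralB //; last by apply: intgZ; exact: plateau_intg.
  by rewrite RintegralZl // ?Q ?subrr //; exact: plateau_intg.
(* The cut-off makes [primitive v], which integrates from [-oo], effectively start at [a]. *)
pose v x := (u x - C) * \1_(`]a, b[) x.
have i1 : intg (\1_(`]a, b[) : R -> R).
  by apply: integrable_indic_itv.
have i1b x : `|\1_(`]a, b[) x : R| <= 1.
  by rewrite indicE; case: (_ \in _); rewrite ?normr1 ?normr0.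
have vi : intg v.
  rewrite /v; under eq_fun do rewrite mulrBl.
  by apply: intgB; [exact: (ub _ 1)|exact: intgZ].
have P0 (q : rat) : a < ratr q < b -> primitive v (ratr q) = 0.
  move=> aqb; have [aq qb] := andP aqb.
  have cv : \int[mu]_x (v x * plateau a (ratr q) k x) @[k --> \oo] -->
            \int[mu]_x (v x * \1_(`]a, ratr q[) x).
    apply: (@dominated_Rintegral _ _ R mu (fun k x => v x * plateau a (ratr q) k x)
      (fun x => v x * \1_(`]a, ratr q[) x) (fun x => `|v x|)).
    - move=> k; apply: measurable_funM; first exact: intg_measurable vi.
      exact: intg_measurable (plateau_intg _ _ _).
    - exact: integrable_norm vi.
    - by move=> k x; rewrite normrM ler_piMr.
    - by move=> x; apply: cvgM; [exact: cvg_cst|exact: plateau_cvg].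
  have v0 : \int[mu]_x (v x * \1_(`]a, ratr q[) x) = 0.
    rewrite -(cvg_lim _ cv) //.
    rewrite (_ : (fun k => _) = cst 0); first by rewrite lim_cst.
    apply/funext => k; rewrite /= -[RHS](uq q k aqb).
    apply: eq_Rintegral => x _; rewrite /v indicE.
    have [xq|xq] := boolP (a < x < ratr q).
      rewrite mem_set ?mulr1 //= in_itv /=.
      by case/andP: xq => -> /= xq; exact: lt_trans qb.
    by rewrite plateau_out ?mulr0.
  rewrite /primitive -Rintegral_itv_bndo_bndc; last exact: integrableS vi.
  rewrite -[RHS]v0 Rintegral_mkcond; apply: eq_Rintegral => x _.
  rewrite patchE /v !indicE; have [xq|qx] := ltP x (ratr q).
    rewrite mem_set /= ?in_itv //; have [ax|xa] := ltP a x.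
      by rewrite [in RHS](_ : (x \in `]a, ratr q[%classic) = true) ?mulr1 // mem_set //= in_itv /= ax.
    by rewrite (_ : (x \in `]a, b[%classic) = false) ?mulr0 ?mul0r // memNset //= in_itv /= ltNge xa.
  rewrite memNset /= ?in_itv /= ?ltNge ?qx //.
  by rewrite [in RHS](_ : (x \in `]a, ratr q[%classic) = false) ?mulr0 // memNset //= in_itv /= (ltNge x) qx andbF.
have V0 x : a < x < b -> primitive v x = 0.
  apply: continuous_dense_eq (primitive_continuous vi) (@dense_rat R) _ x.
  by move=> _ [q _ <-]; exact: P0.
exists C; apply: aeS (primitive_cst_ae0 vi V0) => x vx axb.
move: (vx axb); rewrite /v indicE mem_set ?mulr1 //= ?in_itv //= => /eqP.
by rewrite subr_eq0 /u subr_eq addrC => /eqP ->; rewrite addrC.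
Qed.

End OneDimension.

(** * Absolute continuity on almost every line *)

Section Slicing.
Variable R : realType.
Local Notation mu := (@lebesgue_measure R).
Local Notation mu2 := (@lebesgue_measure R \x @lebesgue_measure R)%E.
Local Notation intg f := (mu.-integrable setT (EFin \o f)).
Local Notation intg2 f := (mu2.-integrable setT (EFin \o f)).

(** The real inner integral is the finite part of the extended one and agrees with it for almost
    every [y]; its integrability comes from [|fine z| <= |z|]. *)
Lemma fubini_slices (K : R * R -> R) : intg2 K ->
  [/\ {ae mu, forall y, intg (fun x => K (x, y))},
      intg (fun y => \int[mu]_x K (x, y)) &
      \int[mu]_y (\int[mu]_x K (x, y)) = \int[mu2]_p K p].
Proof.
move=> Ki; have aeK := ae_integrable2 Ki.
have GE : {ae mu, forall y, setT y ->
    fubini_G mu (EFin \o K) y = (\int[mu]_x K (x, y))%:E}.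
  by apply: aeS aeK => y Ky _; rewrite -EFin_Rintegral.
have mG : measurable_fun setT (fun y => \int[mu]_x K (x, y)).
  apply: measurableT_comp => //; exact: measurable_fubini_G Ki.
split => //.
  apply: (@le_integrable _ _ _ mu setT measurableT _ (fubini_G mu (EFin \o K))).
  - exact/measurable_EFinP.
  - have fine_le (z : \bar R) : (`|fine z|%:E <= `|z|)%E.
      by case: z => [r||] //=; rewrite normr0 leey.
    by move=> y _; exact: fine_le.
  - apply/integrableP; split; first exact: measurable_fubini_G Ki.
    have lty := (integrable21ltyP mu mu (measurable_int mu2 Ki)).1 Ki.
    apply: le_lt_trans lty.
    apply: ge0_le_integral => //.
    + by apply: measurableT_comp => //; exact: measurable_fubini_G Ki.
    + apply: (measurable_fun_fubini_tonelli_G (m1 := mu) (abse \o (EFin \o K))) => //=.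
      by apply: measurableT_comp => //; exact: measurable_int Ki.
    + move=> y _; apply: le_abse_integral => //.
      by apply: measurableT_comp => //; exact: measurable_int Ki.
rewrite {1 3}/Rintegral -(integral21_prod_meas1 Ki).
congr fine; apply/esym; apply: ae_eq_integral => //.
  exact: measurable_fubini_G Ki.
exact/measurable_EFinP.
Qed.

(** The weak derivative in the first variable, tested on products only. This form passes easily
    through the exchange of coordinates. *)
Definition weak_derivx (f g : R * R -> R) := forall F G, test1 F -> test1 G ->
  (\int[mu2]_p (f p * (derive1 F p.1 * G p.2))%:E =
   - \int[mu2]_p (g p * (F p.1 * G p.2))%:E)%E.

Lemma measurable_fst_comp (h : R -> R) : measurable_fun setT h ->
  measurable_fun setT (fun p : R * R => h p.1).
Proof. by move=> mh; apply: measurableT_comp => //; exact: measurable_fst. Qed.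

Lemma measurable_snd_comp (h : R -> R) : measurable_fun setT h ->
  measurable_fun setT (fun p : R * R => h p.2).
Proof. by move=> mh; apply: measurableT_comp => //; exact: measurable_snd. Qed.

Variables f g : R * R -> R.
Hypotheses (mf : measurable_fun setT f) (mg : measurable_fun setT g).
Hypothesis f1 : {ae mu2, forall p, `|f p| <= 1}.
Hypothesis g2 : intg2 (fun p => g p ^+ 2).

Lemma intg_bounded_slice (u v : R -> R) : intg u -> intg v ->
  intg2 (fun p => f p * (u p.1 * v p.2)).
Proof.
move=> ui vi; have uv := tensor_intg ui vi; apply: ae_le_intg uv.
  by apply: measurable_funM => //; exact: intg_measurable (tensor_intg ui vi).
by apply: aeS f1 => p fp; rewrite normrM ler_piMl.
Qed.

(** For a bounded integrable weight [w], [|g w| <= g^2 + w^2] and [w^2 <= M |w|]. *)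
Lemma intg_L2_slice (u v : R -> R) M : intg u -> intg v ->
  (forall x, `|u x| <= M) -> (forall x, `|v x| <= 1) ->
  intg2 (fun p => g p * (u p.1 * v p.2)).
Proof.
move=> ui vi uM v1; have uv := tensor_intg ui vi.
apply: (@le_intg _ _ R mu2 _ (fun p => g p ^+ 2 + M * `|u p.1 * v p.2|)).
- by apply: measurable_funM => //; exact: intg_measurable uv.
- move=> p; set w := u p.1 * v p.2.
  have M0 : 0 <= M by exact: le_trans (normr_ge0 _) (uM 0).
  have wM : `|w| <= M by rewrite normrM -[leRHS]mulr1 ler_pM.
  rewrite [leRHS]ger0_norm ?addr_ge0 ?sqr_ge0 ?mulr_ge0 //.
  have : w ^+ 2 <= M * `|w| by rewrite -real_normK ?num_real // expr2 ler_wpM2r.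
  rewrite ler_norml; nra.
- apply: intgD => //; apply: intgZ; exact: integrable_norm uv.
Qed.

Hypothesis fg : weak_derivx f g.
Variables a b : R.
Hypothesis ab : a < b.

Let box (B : nat) : R -> R := \1_(`](- B%:R), B%:R[).

Lemma indic_intg (c d : R) : intg (\1_(`]c, d[) : R -> R).
Proof. exact: integrable_indic_itv. Qed.

Lemma indic_ooE (c d x : R) : \1_(`]c, d[) x = (c < x < d)%R%:R :> R.
Proof.
rewrite indicE; case: (boolP (c < x < d)) => h; first by rewrite mem_set //= in_itv.
by rewrite memNset //= in_itv /=; exact/negP.
Qed.

Lemma indic_bound (c d x : R) : `|\1_(`]c, d[) x : R| <= 1.
Proof. by rewrite indicE; case: (_ \in _); rewrite ?normr1 ?normr0. Qed.

Lemma test_intg q k : q < b -> intg (test a b q k).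
Proof.
move=> qb; have [t1 _ t0] := testP ab k qb.
have -> : test a b q k = test a b q k \_ `[a, b].
  apply/funext => x; rewrite patchE; case: ifPn => // /negP xab.
  apply: t0; apply: contra_notN xab => /andP[ax xb].
  by rewrite inE /= in_itv /= !ltW.
rewrite -restrict_EFin; apply/(integrable_mkcond _ _).1 => //.
apply: continuous_compact_integrable; first exact: segment_compact.
apply: continuous_subspaceT; exact: (primitive_continuous (dtest_intg _ _ _ _)).
Qed.

Lemma test_bound q k : exists M, forall x, `|test a b q k x| <= M.
Proof. by eexists => x; exact: primitive_bound (dtest_intg a b q k). Qed.

Let pairing q k (p : R * R) := f p * dtest a b q k p.1 + g p * test a b q k p.1.

Lemma pairing_intg q k (v : R -> R) : q < b -> intg v -> (forall x, `|v x| <= 1) ->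
  intg2 (fun p => pairing q k p * v p.2).
Proof.
move=> qb vi v1; have [M tM] := test_bound q k.
rewrite /pairing; under eq_fun do rewrite mulrDl -!mulrA.
apply: intgD; first exact: (intg_bounded_slice (dtest_intg _ _ _ _) vi).
exact: (intg_L2_slice (test_intg k qb) vi tM v1).
Qed.

Lemma pairing_plateau q k c d j : q < b ->
  \int[mu2]_p (pairing q k p * plateau c d j p.2) = 0.
Proof.
move=> qb; have [t1 dt _] := testP ab k qb; have [M tM] := test_bound q k.
have pi := plateau_intg c d j.
have p1 x : `|plateau c d j x| <= 1 by rewrite ger0_norm ?plateau_ge0 ?plateau_le1.
have tp : test1 (plateau c d j).
  by apply: (@bumpy_test1 _ c d); [exact: plateau_bumpy|move=> x; exact: plateau_out].
rewrite /pairing; under eq_Rintegral do rewrite mulrDl -!mulrA.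
have i1 := intg_bounded_slice (dtest_intg a b q k) pi.
have i2 := intg_L2_slice (test_intg k qb) pi tM p1.
rewrite RintegralD //; have := fg t1 tp.
by rewrite dt !EFin_Rintegral //= => -[->]; rewrite addNr.
Qed.

(** The slice integral of [pairing] is orthogonal to all plateaus in the second variable. Sharpening
    those on []-B, d[] kills its primitive at every [d], hence the function itself. The window []-B,
    B[] is there because [f] is merely bounded, so the pairing need not be integrable in the second
    variable. *)
Lemma pairing_slice0 q k B : q < b ->
  {ae mu, forall y, - B%:R < y < B%:R -> \int[mu]_x pairing q k (x, y) = 0}.
Proof.
move=> qb; have Ki := pairing_intg k qb (indic_intg _ _) (indic_bound (- B%:R) B%:R).
have [_ Hi HI] := fubini_slices Ki.
set H := (fun y => _) in Hi.
have P0 d : - B%:R < d < B%:R -> primitive H d = 0.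
  move=> /andP[Bd dB].
  pose K p := pairing q k p * box B p.2 * \1_(`](- B%:R), d[) p.2.
  have K0 : \int[mu2]_p K p = 0.
    have cv : \int[mu2]_p (pairing q k p * box B p.2 * plateau (- B%:R) d j p.2)
        @[j --> \oo] --> \int[mu2]_p K p.
      apply: (@dominated_Rintegral _ _ R mu2
        (fun j p => pairing q k p * box B p.2 * plateau (- B%:R) d j p.2)
        K (fun p => `|pairing q k p * box B p.2|)).
      - move=> j; apply: measurable_funM; first exact: intg_measurable Ki.
        exact: measurable_snd_comp (intg_measurable (plateau_intg _ _ _)).
      - exact: integrable_norm Ki.
      - move=> j p; rewrite normrM ler_piMr //.
        by rewrite ger0_norm ?plateau_ge0 ?plateau_le1.
      - by move=> p; apply: cvgM; [exact: cvg_cst|exact: plateau_cvg].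
    rewrite -(cvg_lim _ cv) // (_ : (fun j => _) = cst 0); first by rewrite lim_cst.
    apply/funext => j; rewrite /= -[RHS](pairing_plateau k (- B%:R) d j qb).
    apply: eq_Rintegral => p _; rewrite -mulrA; congr (_ * _).
    have [/andP[By yd]|yd] := boolP (- B%:R < p.2 < d).
      by rewrite /box indic_ooE By (lt_trans yd dB) mul1r.
    by rewrite plateau_out ?mulr0.
  have Ki' : intg2 K.
    apply: (@intgMb _ _ _ _ 1 _ _ Ki) => [|p]; last exact: indic_bound.
    exact: measurable_snd_comp (intg_measurable (indic_intg _ _)).
  have [_ _] := fubini_slices Ki'; rewrite K0 => K0'.
  rewrite /primitive -Rintegral_itv_bndo_bndc; last exact: integrableS Hi.
  rewrite -[RHS]K0' Rintegral_mkcond; apply: eq_Rintegral => y _.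
  rewrite patchE /K /H /=; have [yd|dy] := ltP y d.
    rewrite mem_set /= ?in_itv //; apply: eq_Rintegral => x _.
    by rewrite /box !indic_ooE yd andbT; case: (- B%:R < y); rewrite ?mulr1 ?mulr0 ?mul0r.
  rewrite memNset /= ?in_itv /= ?ltNge ?dy //.
  rewrite (_ : (fun x => _) = cst 0) ?Rintegral_cst ?mul0r //.
  by apply/funext => x; rewrite indic_ooE (ltNge y) dy andbF mulr0.
apply: aeS (primitive_cst_ae0 Hi P0) => y Hy yB.
rewrite -(Hy yB) /H; apply: eq_Rintegral => x _.
by rewrite indic_ooE ?yB ?xab mulr1.
Qed.

(** Each triple [(q, k, B)] has its own null set of bad lines. There are countably many triples, so
    almost every line satisfies all the identities at once, which is the input of
    [du_bois_reymond]. *)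
Lemma ac_slices : {ae mu, forall y, intg (fun t => g (t, y) * \1_(`]a, b[) t) /\
  exists C, {ae mu, forall x, a < x < b ->
    f (x, y) = C + primitive (fun t => g (t, y) * \1_(`]a, b[) t) x}}.
Proof.
(* Triples are coded by natural numbers so that a sequence of almost-everywhere statements can be
   combined. *)
have aeP : {ae mu, forall y, forall n : nat,
    if unpickle n is Some (q, k, B) then (a < ratr q < b) -> - B%:R < y < B%:R ->
      \int[mu]_x pairing (ratr q) k (x, y) = 0 else True}.
  apply: ae_foralln => n.
  case: (unpickle n : option (rat * nat * nat)) => [[[q k] B]|]; last exact: aeW.
  have [/andP[aq qb]|nq] := boolP (a < ratr q < b); last by apply: aeW => y aqb; case/negP: nq.
  by apply: aeS (pairing_slice0 k B qb) => y H _.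
have aeI1 : {ae mu, forall y, forall B : nat,
    intg (fun x => f (x, y) * (\1_(`]a, b[) x * box B y)) /\
    intg (fun x => g (x, y) * (\1_(`]a, b[) x * box B y))}.
  apply: ae_foralln => B; apply: aeI.
    by case: (fubini_slices (intg_bounded_slice (indic_intg a b) (indic_intg (- B%:R) B%:R))).
  by case: (fubini_slices (intg_L2_slice (indic_intg a b) (indic_intg (- B%:R) B%:R)
    (indic_bound _ _) (indic_bound _ _))).
apply: aeS (aeI aeP aeI1) => y [Py Iy].
have [B yB] : exists B : nat, - B%:R < y < B%:R.
  by exists (Num.truncn `|y|).+1; rewrite -ltr_norml truncnS_gt.
have [fi gi] := Iy B.
have boxy : box B y = 1 by rewrite /box indic_ooE yB.
rewrite boxy in fi gi.
have {}fi : intg (fun x => f (x, y) * \1_(`]a, b[) x).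
  by under eq_fun do rewrite -[\1_ _ _]mulr1.
have {}gi : intg (fun x => g (x, y) * \1_(`]a, b[) x).
  by under eq_fun do rewrite -[\1_ _ _]mulr1.
(* The slices are truncated to []a, b[] to be integrable on the line; both [test] and [dtest] vanish
   outside, so the pairing is unchanged. *)
have [|C HC] := du_bois_reymond ab fi gi.
  move=> q k aqb; have := Py (pickle (q, k, B)); rewrite pickleK => /(_ aqb yB) => <-.
  apply: eq_Rintegral => x _; rewrite /pairing /= -!mulrA.
  have [xab|xab] := boolP (a < x < b).
    by rewrite indic_ooE xab !mul1r.
  have [aq qb] := andP aqb; have [_ _ t0] := testP ab k qb.
  by rewrite t0 // dtest_out // !mulr0.
split=> //; exists C; apply: aeS HC => x Hx xab; rewrite -Hx //.
by rewrite indic_ooE ?yB ?xab mulr1.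
Qed.

End Slicing.

(** * Chain rule and bounds on slices *)

Section PlaneSlices.
Variable R : realType.
Local Notation mu := (@lebesgue_measure R).
Local Notation mu2 := (@lebesgue_measure R \x @lebesgue_measure R)%E.
Local Notation intg f := (mu.-integrable setT (EFin \o f)).
Local Notation intg2 f := (mu2.-integrable setT (EFin \o f)).

Lemma ae_slices (P : R * R -> Prop) : {ae mu2, forall p, P p} ->
  {ae mu, forall y, {ae mu, forall x, P (x, y)}}.
Proof.
move=> [N [mN N0 PN]].
have iN : intg2 (\1_N : R * R -> R).
  apply/integrableP; split; first by apply/measurable_EFinP; exact: measurable_indic.
  under eq_integral do rewrite /= ger0_norm //.
  by rewrite integral_indic // setIT [ltLHS]N0 ltry.
have IN0 : \int[mu2]_p \1_N p = 0 :> R.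
  by rewrite /Rintegral integral_indic // setIT [X in fine X]N0.
have N_ge0 p : 0 <= \1_N p :> R by [].
have [aeN iiN] := fubini_slices iN; rewrite IN0 => /(Rintegral0_ae iiN) aeN0.
have {}aeN0 := aeN0 (fun y => Rintegral_ge0 mu (fun x _ => N_ge0 (x, y))).
apply: aeS (aeI aeN aeN0) => y [iNy iNy0].
apply: aeS (Rintegral0_ae iNy (fun x => N_ge0 (x, y)) iNy0) => x /eqP.
rewrite indicE pnatr_eq0 eqb0 => /negP nN; apply: contrapT => nP; apply: nN.
by rewrite inE; exact: PN.
Qed.

(** A converse of [ae_slices], by Tonelli for [|h|]. It is phrased through a measurable function
    because null slices alone do not make a set measurable. *)
Lemma ae_plane_eq0 (h : R * R -> R) : measurable_fun setT h ->
  {ae mu, forall y, {ae mu, forall x, h (x, y) = 0}} ->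
  {ae mu2, forall p, h p = 0}.
Proof.
move=> mh h0; have mh' : measurable_fun setT (EFin \o h) by exact/measurable_EFinP.
have [+ _] := @ae_eq_integral_abs _ _ _ mu2 setT measurableT (EFin \o h) mh'.
have -> : (\int[mu2]_p `|(EFin \o h) p| = 0)%E.
  have mn : measurable_fun setT (abse \o (EFin \o h)) by exact: measurableT_comp.
  have := fubini_tonelli (m1 := mu) (m2 := mu) _ mn (fun p => abse_ge0 _).
  rewrite -fubini_tonelli1 //= => ->.
  rewrite (ae_eq_integral (cst 0%E)) ?integral0 //.
    by apply: (measurable_fun_fubini_tonelli_G (m1 := mu) (abse \o (EFin \o h))) => //=.
  apply: aeS h0 => y hy _; rewrite (ae_eq_integral (cst 0%E)) ?integral0 //.
    apply/measurable_EFinP; apply: measurableT_comp => //.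
    exact: (measurableT_comp mh (pair2_measurable y)).
  by apply: aeS hy => x /= -> _; rewrite normr0.
by move=> /(_ erefl); apply: aeS => p /(_ I)[].
Qed.

Lemma ae_windows (P : R -> Prop) :
  (forall B : nat, {ae mu, forall x, - B.+1%:R < x < B.+1%:R -> P x}) ->
  {ae mu, forall x, P x}.
Proof.
move=> H; apply: aeS (ae_foralln H) => x Hx; apply: (Hx (Num.truncn `|x|)).
by rewrite -ltr_norml truncnS_gt.
Qed.

Lemma ae_ord3 d (T : measurableType d) (m : {measure set T -> \bar R})
  (P : 'I_3 -> T -> Prop) :
  (forall i, {ae m, forall x, P i x}) -> {ae m, forall x, forall i, P i x}.
Proof.
move=> H; have {}H n : {ae m, forall x, forall i : 'I_3, i = n :> nat -> P i x}.
  have [n3|n3] := ltnP n 3; last first.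
    by apply: aeW => x i ni; move: (ltn_ord i); rewrite ni ltnNge n3.
  apply: aeS (H (Ordinal n3)) => x Px i ni.
  by rewrite (_ : i = Ordinal n3) //; exact: val_inj.
by apply: aeS (ae_foralln H) => x Px i; exact: (Px i).
Qed.

(** The hypotheses of [ac_slices] in one bundle. Only the first variable is covered; the second is
    obtained by applying the bundle to functions composed with the exchange of coordinates. *)
Definition weak_regular (f g : R * R -> R) :=
  [/\ measurable_fun setT f, measurable_fun setT g,
      {ae mu2, forall p, `|f p| <= 1}, intg2 (fun p => g p ^+ 2) & weak_derivx f g].

(** * Orthogonality of a sphere map and its derivative *)

Section ChainRule.
Variables n g : 'I_3 -> R * R -> R.
Hypothesis ng : forall i, weak_regular (n i) (g i).
Hypothesis n1 : {ae mu2, forall p, \sum_(i < 3) n i p ^+ 2 = 1}.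

(** The absolutely continuous representatives have a continuous sum of squares [K], equal to 1 on a
    dense set and so on all of []a, b[]. At almost every point the three primitives are derivable,
    and the derivative of the constant [K] is twice the sum in question. *)
Lemma sphere_slice_orthogonal (N : 'I_3 -> R -> R) (h : 'I_3 -> R -> R)
    (C : 'I_3 -> R) a b :
  (forall i, intg (h i)) ->
  (forall i, {ae mu, forall x, a < x < b -> N i x = C i + primitive (h i) x}) ->
  {ae mu, forall x, \sum_(i < 3) N i x ^+ 2 = 1} ->
  {ae mu, forall x, a < x < b -> \sum_(i < 3) N i x * h i x = 0}.
Proof.
move=> hi NE N1.
pose K x := \sum_(i < 3) (C i + primitive (h i) x) ^+ 2.
have cK : continuous K.
  have c1 i : continuous (fun x => (C i + primitive (h i) x) ^+ 2).
    move=> x; apply: (@continuous_comp _ _ _ (fun x => C i + primitive (h i) x)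
      (fun y => y ^+ 2)); last exact: exprn_continuous.
    by apply: cvgD; [exact: cvg_cst|exact: primitive_continuous].
  rewrite /K; under eq_fun do rewrite !big_ord_recl big_ord0.
  by move=> x; do 3!(apply: cvgD; first exact: c1); exact: cvg_cst.
have aeNE := ae_ord3 NE.
have K1 x : a < x < b -> K x = 1.
  apply: (continuous_dense_eq cK (ae_dense (aeI aeNE N1))) => {}x [NEx <-] xab.
  by apply: eq_bigr => i _; rewrite NEx.
have aed := ae_ord3 (fun i => primitive_ae_derive (hi i)).
apply: aeS (aeI aeNE aed) => x [NEx dx] xab.
have dK : is_derive x 1 K (\sum_(i < 3) (C i + primitive (h i) x) * h i x *+ 2).
  have dp i : is_derive x 1 (fun y => (C i + primitive (h i) y) ^+ 2)
      ((C i + primitive (h i) x) * h i x *+ 2).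
    have d1 : is_derive x 1 (primitive (h i)) (h i x).
      by have [d <-] := dx i; rewrite derive1E; exact/derivableP.
    have d2 := is_deriveD (is_derive_cst (C i) x 1) d1.
    have := is_deriveX 2 d2; rewrite exprfctE => d3.
    by apply: (is_derive_eq d3); rewrite add0r expr1 mulr2n mulrDl mul1r scalerDl.
  by have := is_derive_sum dp; rewrite fct_sumE.
have dK0 : 'D_1 K x = 0.
  transitivity ('D_1 (cst 1 : R -> R) x); last exact: derive_cst.
  case/andP: xab => ax xb; apply: near_eq_derive; near=> y; apply: K1.
  by apply/andP; split; near: y; [exact: lt_nbhsr|exact: lt_nbhsl].
move: dK0; rewrite (@derive_val _ _ _ _ _ _ _ dK) sumrMnl => /eqP.
rewrite mulrn_eq0 /= => /eqP E; rewrite -[RHS]E.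
by apply: eq_bigr => i _; rewrite NEx.
Unshelve. all: by end_near. Qed.

Lemma sphere_orthogonal : {ae mu2, forall p, \sum_(i < 3) n i p * g i p = 0}.
Proof.
have mn i : measurable_fun setT (n i) by case: (ng i).
have mg i : measurable_fun setT (g i) by case: (ng i).
apply: ae_plane_eq0.
  by apply: measurable_sum => i; exact: measurable_funM.
have slices B : {ae mu, forall y, forall i : 'I_3,
    intg (fun t => g i (t, y) * \1_(`](- B.+1%:R), B.+1%:R[) t) /\
    exists C, {ae mu, forall x, - B.+1%:R < x < B.+1%:R ->
      n i (x, y) = C + primitive (fun t => g i (t, y) * \1_(`](- B.+1%:R), B.+1%:R[) t) x}}.
  apply: ae_ord3 => i; have [mni mgi n1i g2i ngi] := ng i.
  by apply: ac_slices => //; rewrite gtrN // ltr0n.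
apply: aeS (aeI (ae_foralln slices) (ae_slices n1)) => y [sly n1y].
apply: ae_windows => B; have {}sly := sly B.
pose C i := projT1 (cid (sly i).2).
have H := @sphere_slice_orthogonal (fun i x => n i (x, y))
  (fun i t => g i (t, y) * \1_(`](- B.+1%:R), B.+1%:R[) t) C (- B.+1%:R) B.+1%:R
  (fun i => (sly i).1) (fun i => projT2 (cid (sly i).2)) n1y.
apply: aeS H => x Hx xB; rewrite -[RHS](Hx xB).
by apply: eq_bigr => i _; rewrite indic_ooE xB mulr1.
Qed.

End ChainRule.

(** * Bounding a function on a line by the L^1 norm of its derivative *)

Section SupBound.
Variables f g : R * R -> R.
Hypothesis fg : weak_regular f g.
Variable c : R.
Let v p := f p - c.
Hypothesis vi : intg2 v.
Hypothesis gi : intg2 g.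

(** Limits at infinity are avoided: on a window, [f] is a constant [C] plus a primitive bounded by
    [S], and averaging [v] over the window bounds [|C - c|] by [S] plus a term that vanishes as the
    window grows. The factor 2 counts [S] once for the constant and once for the primitive. *)
Lemma sup_slice_bound : {ae mu, forall y, {ae mu, forall x,
  `|v (x, y)| <= 2 * \int[mu]_t `|g (t, y)|}}.
Proof.
have [mf mg f1 g2 wfg] := fg.
have [aev _ _] := fubini_slices vi; have [aeg _ _] := fubini_slices gi.
have slices (B : nat) : {ae mu, forall y,
    intg (fun t => g (t, y) * \1_(`](- B.+1%:R), B.+1%:R[) t) /\
    exists C, {ae mu, forall x, - B.+1%:R < x < B.+1%:R ->
      f (x, y) = C + primitive (fun t => g (t, y) * \1_(`](- B.+1%:R), B.+1%:R[) t) x}}.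
  by apply: ac_slices => //; rewrite gtrN // ltr0n.
apply: aeS (aeI (aeI aev aeg) (ae_foralln slices)) => y [[vy gy] sly].
set S := \int[mu]_t `|g (t, y)|; pose V := \int[mu]_x `|v (x, y)|.
have key (B : nat) : {ae mu, forall x, - B.+1%:R < x < B.+1%:R ->
    `|v (x, y)| <= 2 * S + V / B.+1%:R}.
  have [hB [C HC]] := sly B; set h := (fun t => _) in hB HC.
  have hS x : `|primitive h x| <= S.
    apply: le_trans (primitive_bound x hB) _; apply: le_Rintegral => //.
    - exact: integrable_norm hB.
    - exact: integrable_norm gy.
    - by move=> t _; rewrite normrM ler_piMr // indic_bound.
  have B0 : 0 < B.+1%:R :> R by rewrite ltr0n.
  (* On the window [|C - c| - S <= |v|] almost everywhere; integrate over its length [2 * B.+1]. *)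
  have CB : `|C - c| <= S + V / B.+1%:R / 2.
    have ic : intg (fun x : R => (`|C - c| - S) * \1_(`](- B.+1%:R), B.+1%:R[) x).
      exact: intgZ (indic_intg _ _).
    have : \int[mu]_x ((`|C - c| - S) * \1_(`](- B.+1%:R), B.+1%:R[) x) <= V.
      apply: ae_le_Rintegral => //; first exact: integrable_norm vy.
      apply: aeS HC => x HCx; rewrite indic_ooE.
      have [xB|_] := boolP (_ < x < _); last by rewrite mulr0.
      rewrite mulr1 lerBlDr /v HCx // (_ : C - c = C + primitive h x - c - primitive h x).
        by rewrite (le_trans (ler_normB _ _)) // lerD2l.
      by rewrite addrAC addrK.
    rewrite RintegralZl //; last exact: indic_intg.
    rewrite /Rintegral integral_indic // setIT [X in fine X]lebesgue_measure_itv /=.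
    rewrite lte_fin gtrN // -EFinB /= => le_V.
    rewrite -lerBlDl ler_pdivlMr // ler_pdivlMr //; apply: le_trans le_V.
    by rewrite le_eqVlt; apply/orP; left; apply/eqP; ring.
  apply: aeS HC => x HCx xB; rewrite /v HCx // addrAC.
  rewrite (le_trans (ler_normD _ _)) // (le_trans (lerD CB (hS x))) //.
  have : 0 <= V / B.+1%:R by rewrite divr_ge0 // Rintegral_ge0.
  set z := V / _; lra.
have {}key := ae_foralln key.
apply: aeS key => x keyx; apply/ler_addgt0Pr => e e0.
have V0 : 0 <= V by apply: Rintegral_ge0.
(* Large enough for the window to contain [x] and for [V / B.+1] to be at most [e]. *)
pose B := Num.truncn (`|x| + V / e).
have xVB : `|x| + V / e < B.+1%:R by rewrite truncnS_gt.
have xB : - B.+1%:R < x < B.+1%:R.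
  by rewrite -ltr_norml (le_lt_trans _ xVB) // lerDl divr_ge0 // ltW.
apply: le_trans (keyx B xB) _; rewrite lerD2l ler_pdivrMr ?ltr0n //.
rewrite mulrC -ler_pdivrMr // ltW // (le_lt_trans _ xVB) // lerDr.
exact: normr_ge0.
Qed.

End SupBound.
End PlaneSlices.

(** * Exchange of coordinates and the Gagliardo-Nirenberg inequality *)

Section Swap.
Variable R : realType.
Local Notation mu := (@lebesgue_measure R).
Local Notation mu2 := (@lebesgue_measure R \x @lebesgue_measure R)%E.
Local Notation intg f := (mu.-integrable setT (EFin \o f)).
Local Notation intg2 f := (mu2.-integrable setT (EFin \o f)).

Definition swap (p : R * R) : R * R := (p.2, p.1).

Lemma swap_measurable : measurable_fun setT swap.
Proof. by apply/measurable_fun_pair; [exact: measurable_snd|exact: measurable_fst]. Qed.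

Lemma measurable_comp_swap d (T : measurableType d) (h : R * R -> T) :
  measurable_fun setT h -> measurable_fun setT (h \o swap).
Proof. by move=> mh; apply: measurableT_comp => //; exact: swap_measurable. Qed.

(** Tonelli is applied to the positive and negative parts separately, which covers every measurable
    function; the weak derivative identity, between extended integrals, can then be transported as
    it stands. *)
Lemma integral_swap (h : R * R -> \bar R) : measurable_fun setT h ->
  (\int[mu2]_p h (swap p) = \int[mu2]_p h p)%E.
Proof.
have ge0 (k : R * R -> \bar R) : measurable_fun setT k -> (forall p, 0 <= k p)%E ->
    (\int[mu2]_p k (swap p) = \int[mu2]_p k p)%E.
  move=> mk k0.
  have mks : measurable_fun setT (k \o swap) by exact: measurable_comp_swap mk.
  rewrite (fubini_tonelli1 (m1 := mu) (m2 := mu) (k \o swap) mks (fun p => k0 (swap p))).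
  rewrite [RHS](fubini_tonelli1 (m1 := mu) (m2 := mu) k mk k0).
  by rewrite [RHS](fubini_tonelli (m1 := mu) (m2 := mu) k mk k0).
move=> mh; rewrite integralE [RHS]integralE.
have P := ge0 (h^\+)%E (measurable_funepos mh) (fun p => funepos_ge0 h p).
have N := ge0 (h^\-)%E (measurable_funeneg mh) (fun p => funeneg_ge0 h p).
rewrite -P -N; congr (_ - _)%E; apply: eq_integral => p _.
  by rewrite !funeposE.
by rewrite !funenegE.
Qed.

Lemma intg2_swap (h : R * R -> R) : intg2 h -> intg2 (h \o swap).
Proof.
move=> /integrableP[mh hi]; apply/integrableP; split.
  exact: (measurable_comp_swap mh).
rewrite (integral_swap (h := abse \o (EFin \o h))) //.
exact: measurableT_comp.
Qed.

Lemma Rintegral_swap (h : R * R -> R) : measurable_fun setT h ->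
  \int[mu2]_p h (swap p) = \int[mu2]_p h p.
Proof.
move=> mh; congr fine; apply: (integral_swap (h := EFin \o h)).
exact/measurable_EFinP.
Qed.

Lemma ae_swap (P : R * R -> Prop) : {ae mu2, forall p, P p} ->
  {ae mu2, forall p, P (swap p)}.
Proof.
move=> [N [mN N0 PN]].
have mS : measurable (swap @^-1` N).
  by rewrite -[X in measurable X]setTI; exact: swap_measurable.
exists (swap @^-1` N); split => //; last by move=> p /= nP; exact: (PN (swap p)).
transitivity (\int[mu2]_p (\1_(swap @^-1` N) p)%:E)%E.
  by rewrite integral_indic // setIT.
transitivity (\int[mu2]_p (\1_N p)%:E)%E; last by rewrite integral_indic // setIT.
rewrite -[RHS]integral_swap //.
by apply/measurable_EFinP; exact: measurable_indic.
Qed.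

Lemma weak_deriv_x (f g : R * R -> R) (j : 'I_2) : j = 0%N :> nat -> weak_deriv f g j -> weak_derivx f g.
Proof.
move=> j0 fg F G tF tG; have := fg _ (tensor_test_fun tF tG).
have [sF _] := tF; have [sG _] := tG.
by rewrite (@partial_tensor _ _ F G (sF 0%N) (sG 0%N)) j0.
Qed.

Lemma weak_deriv_y (f g : R * R -> R) (j : 'I_2) : j = 1%N :> nat ->
  measurable_fun setT f -> measurable_fun setT g ->
  weak_deriv f g j -> weak_derivx (f \o swap) (g \o swap).
Proof.
move=> j1 mf mg fg F G tF tG; have := fg _ (tensor_test_fun tG tF).
have [sF _] := tF; have [sG _] := tG.
rewrite (@partial_tensor _ _ G F (sG 0%N) (sF 0%N)) j1 /=.
have mt n (h : R -> R) : smooth1 h -> measurable_fun setT (derive1n n h).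
  by move=> sh; apply: continuous_measurable_fun; exact: smooth1_continuous.
have mG : measurable_fun setT G := mt 0%N _ sG.
have mF : measurable_fun setT F := mt 0%N _ sF.
have mF' : measurable_fun setT (derive1 F) := mt 1%N _ sF.
have m1 : measurable_fun setT (fun p : R * R => (f p * (G p.1 * derive1 F p.2))%:E).
  apply/measurable_EFinP; apply: measurable_funM => //; apply: measurable_funM.
    exact: (measurable_fst_comp mG).
  exact: (measurable_snd_comp mF').
have m2 : measurable_fun setT (fun p : R * R => (g p * (G p.1 * F p.2))%:E).
  apply/measurable_EFinP; apply: measurable_funM => //; apply: measurable_funM.
    exact: (measurable_fst_comp mG).
  exact: (measurable_snd_comp mF).
rewrite -(integral_swap m1) -(integral_swap m2) /= => H.
under eq_integral do rewrite [derive1 F _ * _]mulrC.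
by rewrite H; congr (- _)%E; apply: eq_integral => p _; rewrite /= [F _ * _]mulrC.
Qed.

(** [ae_plane_eq0] applied to the positive part of [h - k]. *)
Lemma ae_plane_le (h k : R * R -> R) : measurable_fun setT h -> measurable_fun setT k ->
  {ae mu, forall y, {ae mu, forall x, h (x, y) <= k (x, y)}} ->
  {ae mu2, forall p, h p <= k p}.
Proof.
move=> mh mk hk.
have : {ae mu2, forall p, Num.max (h p - k p) 0 = 0}.
  apply: ae_plane_eq0.
    by apply: measurable_maxr => //; exact: measurable_funB.
  by apply: aeS hk => y; apply: aeS => x hkx; rewrite max_r // subr_le0.
by apply: aeS => p /eqP; rewrite -subr_le0 => /eqP <-; rewrite le_max lexx.
Qed.

Lemma Rintegral_tensor (u v : R -> R) : intg u -> intg v ->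
  \int[mu2]_p (u p.1 * v p.2) = (\int[mu]_x u x) * \int[mu]_y v y.
Proof.
move=> ui vi; have [_ _ <-] := fubini_slices (tensor_intg ui vi).
by under eq_Rintegral do rewrite /= RintegralZr //; rewrite RintegralZl.
Qed.

(* The factor 4 instead of 1 comes from the crude constant 2 in [sup_slice_bound]. *)
Lemma gagliardo_nirenberg (f g0 g1 : R * R -> R) c :
  weak_regular f g0 -> weak_regular (f \o swap) (g1 \o swap) ->
  intg2 (fun p => f p - c) -> intg2 g0 -> intg2 g1 ->
  intg2 (fun p => (f p - c) ^+ 2) /\
  \int[mu2]_p ((f p - c) ^+ 2) <= 4 * (\int[mu2]_p `|g0 p| * \int[mu2]_p `|g1 p|).
Proof.
move=> r0 r1 vi i0 i1; pose v p := f p - c.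
have mv : measurable_fun setT v by exact: intg_measurable vi.
have slice g : intg2 g -> intg (fun y => \int[mu]_x `|g (x, y)|) /\
    \int[mu]_y (\int[mu]_x `|g (x, y)|) = \int[mu2]_p `|g p|.
  by move=> gi; have [_ ? ?] := fubini_slices (integrable_norm gi).
have bound h g : weak_regular h g -> intg2 (fun p => h p - c) -> intg2 g ->
    {ae mu2, forall p, `|h p - c| <= 2 * \int[mu]_t `|g (t, p.2)|}.
  move=> hg hi gi; have [si _] := slice _ gi; apply: ae_plane_le.
  - by apply: measurableT_comp => //; exact: intg_measurable hi.
  - apply: measurable_funM => //; exact: measurable_snd_comp (intg_measurable si).
  - exact: sup_slice_bound.
have [A0i A0E] := slice _ i0; have [A1i A1E] := slice _ (intg2_swap i1).
have mg1 : measurable_fun setT (fun p => `|g1 p|).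
  by apply: measurableT_comp => //; exact: intg_measurable i1.
have {}A1E := etrans A1E (Rintegral_swap mg1).
have b0 := bound _ _ r0 vi i0.
have b1 := ae_swap (bound _ _ r1 (intg2_swap vi) (intg2_swap i1)).
set A0 := (fun y => _) in A0i A0E; set A1 := (fun y => _) in A1i A1E.
have ti : intg2 (fun p => 4 * (A1 p.1 * A0 p.2)) by apply: intgZ; exact: tensor_intg.
(* The bound along the first variable depends on [y] alone and the one along the second on [x]
   alone, so their product is a tensor product whose integral factors. *)
have v2 : {ae mu2, forall p, v p ^+ 2 <= 4 * (A1 p.1 * A0 p.2)}.
  apply: aeS (aeI b0 b1) => -[x y] /= [v0 v1].
  rewrite -real_normK ?num_real // expr2.
  apply: le_trans (ler_pM _ _ v1 v0) _ => //.
  by rewrite le_eqVlt; apply/orP; left; apply/eqP; rewrite /A0 /A1 /=; ring.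
have v2i : intg2 (fun p => v p ^+ 2).
  apply: ae_le_intg ti; first exact: measurable_funX.
  apply: aeS v2 => p vp; rewrite ger0_norm ?sqr_ge0 //.
  exact: le_trans vp (ler_norm _).
split => //; apply: le_trans (ae_le_Rintegral v2i ti v2) _.
have tE : \int[mu2]_p (A1 p.1 * A0 p.2) = \int[mu2]_p `|g0 p| * \int[mu2]_p `|g1 p|.
  by rewrite mulrC -A1E -A0E; exact: Rintegral_tensor.
have := RintegralZl 4 measurableT (tensor_intg A1i A0i).
by rewrite tE => ->.
Qed.

End Swap.

(** * Energy estimates *)

Section Estimates.
Variable R : realType.
Local Notation mu := (@lebesgue_measure R).
Local Notation mu2 := (@lebesgue_measure R \x @lebesgue_measure R)%E.
Local Notation intg2 f := (mu2.-integrable setT (EFin \o f)).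

Lemma sum_inord3 (F : 'I_3 -> R) :
  \sum_(i < 3) F i = F (inord 0) + F (inord 1) + F (inord 2).
Proof.
rewrite !big_ord_recl big_ord0 addr0 addrA.
by congr (F _ + F _ + F _); apply/val_inj; rewrite /= inordK.
Qed.

Lemma sum_inord2 (F : 'I_2 -> R) : \sum_(i < 2) F i = F (inord 0) + F (inord 1).
Proof.
rewrite !big_ord_recl big_ord0 addr0.
by congr (F _ + F _); apply/val_inj; rewrite /= inordK.
Qed.

Lemma amgm (k w g t : R) : 0 < t -> `|k| <= w -> `|k * g| <= (w ^+ 2 / t + t * g ^+ 2) / 2.
Proof.
move=> t0 kw; have w0 : 0 <= w by exact: le_trans (normr_ge0 _) kw.
rewrite normrM (le_trans (ler_wpM2r (normr_ge0 g) kw)) //.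
rewrite -[g ^+ 2]real_normK ?num_real //; move: `|g| => y.
have -> : w ^+ 2 / t = t * (w / t) ^+ 2 by field; rewrite gt_eqF.
have {1}-> : w = t * (w / t) by rewrite mulrC divfK // gt_eqF.
move: (w / t) => z.
have : 0 <= t * (z - y) ^+ 2 by rewrite mulr_ge0 ?sqr_ge0 // ltW.
lra.
Qed.

(** Orthogonality gives [g2j = - (m0 g0j + m1 g1j + v g2j)]. Substituting this in the two terms
    linear in [m0] and [m1], the density becomes a sum of eight products of a gradient entry with a
    coefficient bounded by [w]; the coefficient [v] already is, since [v = - w / 2]. Young's
    inequality costs [w^2 / (2t)] for each, hence the 4, and no gradient entry occurs more than
    twice. *)
Lemma helicity_density_bound (m0 m1 v g00 g01 g10 g11 g20 g21 t : R) : 0 < t ->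
  let w := m0 ^+ 2 + m1 ^+ 2 + v ^+ 2 in
  v = - w / 2 ->
  m0 * g00 + m1 * g10 + (v + 1) * g20 = 0 -> m0 * g01 + m1 * g11 + (v + 1) * g21 = 0 ->
  `|m0 * g21 + m1 * - g20 + v * (g10 - g01)| <= 4 * (w ^+ 2 / t) +
    t * (g00 ^+ 2 + g01 ^+ 2 + (g10 ^+ 2 + g11 ^+ 2) + (g20 ^+ 2 + g21 ^+ 2)).
Proof.
move=> t0 w vw o0 o1.
have -> : m0 * g21 + m1 * - g20 + v * (g10 - g01) =
    - (m0 * m0 * g01) - m0 * m1 * g11 - m0 * v * g21 +
    (m1 * m0 * g00 + m1 * m1 * g10 + m1 * v * g20) + (v * g10 - v * g01).
  have e1 : m0 * (m0 * g01 + m1 * g11 + (v + 1) * g21) = 0 by rewrite o1 mulr0.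
  have e0 : m1 * (m0 * g00 + m1 * g10 + (v + 1) * g20) = 0 by rewrite o0 mulr0.
  by lra.
have w0 : 0 <= w by rewrite /w; nra.
have B k g : `|k| <= w -> `|k * g| <= (w ^+ 2 / t + t * g ^+ 2) / 2 by exact: amgm.
have c00 : `|m0 * m0 * g01| <= (w ^+ 2 / t + t * g01 ^+ 2) / 2.
  by apply: B; rewrite ler_norml /w; nra.
have c01 : `|m0 * m1 * g11| <= (w ^+ 2 / t + t * g11 ^+ 2) / 2.
  by apply: B; rewrite ler_norml /w; nra.
have c02 : `|m0 * v * g21| <= (w ^+ 2 / t + t * g21 ^+ 2) / 2.
  by apply: B; rewrite ler_norml /w; nra.
have c10 : `|m1 * m0 * g00| <= (w ^+ 2 / t + t * g00 ^+ 2) / 2.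
  by apply: B; rewrite ler_norml /w; nra.
have c11 : `|m1 * m1 * g10| <= (w ^+ 2 / t + t * g10 ^+ 2) / 2.
  by apply: B; rewrite ler_norml /w; nra.
have c12 : `|m1 * v * g20| <= (w ^+ 2 / t + t * g20 ^+ 2) / 2.
  by apply: B; rewrite ler_norml /w; nra.
have vlew : `|v| <= w by rewrite vw ler_norml; lra.
have cv1 := B v g10 vlew; have cv2 := B v g01 vlew.
have tg (g : R) : 0 <= t * g ^+ 2 by rewrite mulr_ge0 ?sqr_ge0 // ltW.
have := tg g00; have := tg g01; have := tg g10.
have := tg g11; have := tg g20; have := tg g21.
move: c00 c01 c02 c10 c11 c12 cv1 cv2; rewrite !mulrDr !ler_norml.
move: (w ^+ 2 / t) (t * g00 ^+ 2) (t * g01 ^+ 2) (t * g10 ^+ 2) (t * g11 ^+ 2)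
  (t * g20 ^+ 2) (t * g21 ^+ 2) => X q00 q01 q10 q11 q20 q21.
lra.
Qed.

(** The same substitution for [g2], but with coefficients kept linear in m: after integration this
    yields an L^1 bound by the product of the L^2 norms of m and its gradient. *)
Lemma orthogonal_component_bound (m0 m1 v g0 g1 g2 s : R) : 0 < s ->
  m0 * g0 + m1 * g1 + (v + 1) * g2 = 0 ->
  2 * `|g2| <= (m0 ^+ 2 + m1 ^+ 2 + v ^+ 2) / s + s * (g0 ^+ 2 + g1 ^+ 2 + g2 ^+ 2).
Proof.
move=> s0 o; have g2E : g2 = - (m0 * g0) - m1 * g1 - v * g2 by lra.
have B k g : `|k * g| <= (k ^+ 2 / s + s * g ^+ 2) / 2.
  by rewrite -[k ^+ 2]real_normK ?num_real //; exact: amgm.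
have := B m0 g0; have := B m1 g1; have := B v g2.
rewrite -ler_pdivlMl // !ler_norml; lra.
Qed.

(** Recovers Cauchy-Schwarz from Young's inequality with a free parameter: at [s = W / I] the first
    term on the right is [I]. *)
Lemma sqr_le_of_amgm (I W Q : R) : 0 <= I -> 0 < W -> 0 <= Q ->
  (forall s, 0 < s -> 2 * I <= W / s + s * Q) -> I ^+ 2 <= W * Q.
Proof.
move=> I0 W0 Q0 H; have [->|I1] := eqVneq I 0.
  by rewrite expr0n /= mulr_ge0 // ltW.
have {}I0 : 0 < I by rewrite lt_def I1.
have := H (W / I) (divr_gt0 W0 I0).
have -> : W / (W / I) = I by field; rewrite !gt_eqF.
by rewrite mulr_natl mulr2n lerD2l mulrAC ler_pdivlMr // expr2.
Qed.

End Estimates.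

(** * Integral bounds for a fixed sphere map *)

Section Energy.
Variable R : realType.
Local Notation mu := (@lebesgue_measure R).
Local Notation mu2 := (@lebesgue_measure R \x @lebesgue_measure R)%E.
Local Notation intg2 f := (mu2.-integrable setT (EFin \o f)).

Variables (n : 'I_3 -> R * R -> R) (G : 'I_3 -> 'I_2 -> R * R -> R).

Definition dist_sq p := \sum_(i < 3) (n i p - e3 R i) ^+ 2.
Definition grad_sq p := \sum_(i < 3) \sum_(j < 2) G i j p ^+ 2.
Definition helicity p := \sum_(i < 3) (n i p - e3 R i) * curl G i p.

Lemma dist_sqE p : dist_sq p =
  n (inord 0) p ^+ 2 + n (inord 1) p ^+ 2 + (n (inord 2) p - 1) ^+ 2.
Proof. by rewrite /dist_sq sum_inord3 /e3 !inordK //= !subr0. Qed.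

Lemma grad_sqE p : grad_sq p =
  G (inord 0) (inord 0) p ^+ 2 + G (inord 0) (inord 1) p ^+ 2 +
  (G (inord 1) (inord 0) p ^+ 2 + G (inord 1) (inord 1) p ^+ 2) +
  (G (inord 2) (inord 0) p ^+ 2 + G (inord 2) (inord 1) p ^+ 2).
Proof. by rewrite /grad_sq sum_inord3 !sum_inord2. Qed.

Lemma helicityE p : helicity p =
  n (inord 0) p * G (inord 2) (inord 1) p +
  n (inord 1) p * - G (inord 2) (inord 0) p +
  (n (inord 2) p - 1) * (G (inord 1) (inord 0) p - G (inord 0) (inord 1) p).
Proof. by rewrite /helicity sum_inord3 /e3 /curl !inordK //= !subr0. Qed.

Lemma dist_sq_ge0 p : 0 <= dist_sq p.
Proof. by apply: sumr_ge0 => i _; exact: sqr_ge0. Qed.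

Lemma grad_sq_ge0 p : 0 <= grad_sq p.
Proof. by apply: sumr_ge0 => i _; apply: sumr_ge0 => j _; exact: sqr_ge0. Qed.

Hypothesis nS : sphere_map n.
Hypothesis nG : forall i j, L2loc (G i j) /\ weak_deriv (n i) (G i j) j.

Lemma measurable_component i : measurable_fun setT (n i). Proof. by case: nS. Qed.

Lemma measurable_gradient i j : measurable_fun setT (G i j). Proof. by case: (nG i j) => -[]. Qed.

Lemma measurable_dist_sq : measurable_fun setT dist_sq.
Proof.
apply: measurable_sum => i; apply: measurable_funX.
by apply: measurable_funB => //; exact: measurable_component.
Qed.

Lemma measurable_grad_sq : measurable_fun setT grad_sq.
Proof.
apply: measurable_sum => i; apply: measurable_sum => j.
by apply: measurable_funX; exact: measurable_gradient.
Qed.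

Lemma measurable_helicity : measurable_fun setT helicity.
Proof.
rewrite (_ : helicity = fun p => n (inord 0) p * G (inord 2) (inord 1) p +
  n (inord 1) p * - G (inord 2) (inord 0) p +
  (n (inord 2) p - 1) * (G (inord 1) (inord 0) p - G (inord 0) (inord 1) p)); last first.
  by apply/funext => p; exact: helicityE.
apply: measurable_funD; first apply: measurable_funD.
- by apply: measurable_funM; [exact: measurable_component|exact: measurable_gradient].
- apply: measurable_funM; first exact: measurable_component.
  by apply: measurableT_comp => //; exact: measurable_gradient.
- apply: measurable_funM; first by apply: measurable_funB => //; exact: measurable_component.
  by apply: measurable_funB; exact: measurable_gradient.
Qed.

Hypothesis Wi : intg2 dist_sq.
Hypothesis Qi : intg2 grad_sq.

Let W := \int[mu2]_p dist_sq p.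
Let Q := \int[mu2]_p grad_sq p.

Lemma G_sq_intg i j : intg2 (fun p => G i j p ^+ 2).
Proof.
apply: le_intg Qi; first by apply: measurable_funX; exact: measurable_gradient.
move=> p; rewrite !ger0_norm ?sqr_ge0 ?grad_sq_ge0 // /grad_sq.
rewrite (bigD1 i) //= (bigD1 j) //= -addrA lerDl addr_ge0 //.
  by apply: sumr_ge0 => k _; exact: sqr_ge0.
by apply: sumr_ge0 => k _; apply: sumr_ge0 => l _; exact: sqr_ge0.
Qed.

Lemma n_le1 i : {ae mu2, forall p, `|n i p| <= 1}.
Proof.
have [_] := nS; apply: aeS => p np.
rewrite -(@ler_pXn2r _ 2) ?nnegrE // expr1n real_normK ?num_real // -np.
by rewrite (bigD1 i) //= lerDl; apply: sumr_ge0 => k _; exact: sqr_ge0.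
Qed.

Lemma weak_regular_x i : weak_regular (n i) (G i (inord 0)).
Proof.
have [_ nGi] := nG i (inord 0).
split; [exact: measurable_component|exact: measurable_gradient|exact: n_le1|exact: G_sq_intg|].
by apply: weak_deriv_x nGi; rewrite inordK.
Qed.

Lemma weak_regular_y i : weak_regular (n i \o @swap R) (G i (inord 1) \o @swap R).
Proof.
have [_ nGi] := nG i (inord 1); split.
- exact: measurable_comp_swap (measurable_component i).
- exact: measurable_comp_swap (measurable_gradient i (inord 1)).
- exact: ae_swap (n_le1 i).
- exact: intg2_swap (G_sq_intg i (inord 1)).
- by apply: weak_deriv_y nGi; [rewrite inordK|exact: measurable_component|exact: measurable_gradient].
Qed.

Lemma sphere_facts : {ae mu2, forall p,
  [/\ n (inord 2) p - 1 = - dist_sq p / 2,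
      n (inord 0) p * G (inord 0) (inord 0) p + n (inord 1) p * G (inord 1) (inord 0) p +
        (n (inord 2) p - 1 + 1) * G (inord 2) (inord 0) p = 0 &
      n (inord 0) p * G (inord 0) (inord 1) p + n (inord 1) p * G (inord 1) (inord 1) p +
        (n (inord 2) p - 1 + 1) * G (inord 2) (inord 1) p = 0]}.
Proof.
have ox := sphere_orthogonal weak_regular_x nS.2.
(* The second direction: the chain rule for the swapped map, read back in the original
   coordinates. *)
have oy := ae_swap (sphere_orthogonal weak_regular_y (ae_swap nS.2)).
apply: aeS (aeI nS.2 (aeI ox oy)) => -[x y] [n1 [{}ox {}oy]].
rewrite sum_inord3 in n1; rewrite sum_inord3 in ox; rewrite sum_inord3 /= in oy.
rewrite subrK; split => //; rewrite dist_sqE; lra.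
Qed.

Lemma vertical_intg : intg2 (fun p => n (inord 2) p - 1).
Proof.
apply: ae_le_intg Wi; first by apply: measurable_funB => //; exact: measurable_component.
apply: aeS sphere_facts => p [-> _ _]; have := dist_sq_ge0 p => w0.
by rewrite mulNr normrN !ger0_norm ?divr_ge0 //; lra.
Qed.

Lemma vertical_gradient_bound j s : 0 < s -> (j = 0%N :> nat \/ j = 1%N :> nat) ->
  {ae mu2, forall p, 2 * `|G (inord 2) (inord j) p| <= dist_sq p / s + s * grad_sq p}.
Proof.
move=> s0 j01; apply: aeS sphere_facts => p [_ o0 o1].
have sq0 (g : R) : 0 <= s * g ^+ 2 by rewrite mulr_ge0 ?sqr_ge0 // ltW.
rewrite dist_sqE grad_sqE; case: j01 => ->.
  apply: le_trans (orthogonal_component_bound s0 o0) _; rewrite lerD2l ler_pM2l //.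
  have := sqr_ge0 (G (inord 0) (inord 1) p); have := sqr_ge0 (G (inord 1) (inord 1) p).
  have := sqr_ge0 (G (inord 2) (inord 1) p); lra.
apply: le_trans (orthogonal_component_bound s0 o1) _; rewrite lerD2l ler_pM2l //.
have := sqr_ge0 (G (inord 0) (inord 0) p); have := sqr_ge0 (G (inord 1) (inord 0) p).
have := sqr_ge0 (G (inord 2) (inord 0) p); lra.
Qed.

Lemma vertical_gradient_intg j : (j = 0%N :> nat \/ j = 1%N :> nat) ->
  intg2 (G (inord 2) (inord j)).
Proof.
move=> j01; apply: ae_le_intg (intgD Wi Qi); first exact: measurable_gradient.
apply: aeS (vertical_gradient_bound ltr01 j01) => p; rewrite divr1 mul1r => Gp.
apply: le_trans (ler_norm _); apply: le_trans Gp.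
by rewrite ler_peMl // ler1n.
Qed.

(** The pointwise Young bound is integrated for each fixed [s], with a null set that may depend on
    [s]; the parameter is optimised only afterwards, between numbers. *)
Lemma vertical_gradient_L1 j : (j = 0%N :> nat \/ j = 1%N :> nat) -> 0 < W ->
  (\int[mu2]_p `|G (inord 2) (inord j) p|) ^+ 2 <= W * Q.
Proof.
move=> j01 W0; have Gi := integrable_norm (vertical_gradient_intg j01).
apply: sqr_le_of_amgm => //; first exact: Rintegral_ge0.
  by apply: Rintegral_ge0 => p _; exact: grad_sq_ge0.
move=> s s0; rewrite mulrC [W / s]mulrC.
have Wsi := intgZ s^-1 Wi; have Qsi := intgZ s Qi.
rewrite -(RintegralZl s^-1 measurableT Wi) -(RintegralZl s measurableT Qi).
rewrite -RintegralD // mulrC -RintegralZl //.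
apply: ae_le_Rintegral; [exact: intgZ|exact: intgD|].
by apply: aeS (vertical_gradient_bound s0 j01) => p; rewrite [dist_sq p / s]mulrC.
Qed.

(** The constant is 4 * 4: one factor from |m|^4 = 4 m_3^2, the other from [gagliardo_nirenberg].
    The product of the two L^1 norms is at most half the sum of their squares, hence at most
    [W * Q]. *)
Lemma dist_sq_sq_intg : 0 < W ->
  intg2 (fun p => dist_sq p ^+ 2) /\ \int[mu2]_p dist_sq p ^+ 2 <= 16 * (W * Q).
Proof.
move=> W0.
have i0 := vertical_gradient_intg (or_introl (erefl 0%N)).
have i1 := vertical_gradient_intg (or_intror (erefl 1%N)).
have [v2i v2] := gagliardo_nirenberg (weak_regular_x (inord 2))
  (weak_regular_y (inord 2)) vertical_intg i0 i1.
have L0 := vertical_gradient_L1 (or_introl (erefl 0%N)) W0.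
have L1 := vertical_gradient_L1 (or_intror (erefl 1%N)) W0.
have v4i := intgZ 4 v2i.
have w2 : {ae mu2, forall p, dist_sq p ^+ 2 <= 4 * (n (inord 2) p - 1) ^+ 2}.
  by apply: aeS sphere_facts => p [-> _ _]; nra.
have w2i : intg2 (fun p => dist_sq p ^+ 2).
  apply: ae_le_intg v4i; first exact: measurable_funX measurable_dist_sq.
  apply: aeS w2 => p wp; rewrite ger0_norm ?sqr_ge0 //.
  exact: le_trans wp (ler_norm _).
split => //; apply: le_trans (ae_le_Rintegral w2i v4i w2) _.
rewrite (RintegralZl 4 measurableT v2i).
move: v2 L0 L1; set V := \int[mu2]_p _; set I0 := \int[mu2]_p _; set I1 := \int[mu2]_p _.
move: (W * Q) => WQ v2 L0 L1; have := sqr_ge0 (I0 - I1); nra.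
Qed.

Lemma helicity_estimate t : 0 < t -> 0 < W -> intg2 helicity /\
  `|\int[mu2]_p helicity p| <= 4 * (\int[mu2]_p dist_sq p ^+ 2) / t + t * Q.
Proof.
move=> t0 W0; have [w2i _] := dist_sq_sq_intg W0.
have hb : {ae mu2, forall p, `|helicity p| <= 4 / t * dist_sq p ^+ 2 + t * grad_sq p}.
  apply: aeS sphere_facts => p []; rewrite helicityE dist_sqE => wE o0 o1.
  have := helicity_density_bound t0 wE o0 o1; rewrite grad_sqE => /le_trans; apply.
  by rewrite lerD2r le_eqVlt; apply/orP; left; apply/eqP; ring.
have bi := intgD (intgZ (4 / t) w2i) (intgZ t Qi).
have hi : intg2 helicity.
  apply: ae_le_intg bi; first exact: measurable_helicity.
  by apply: aeS hb => p /le_trans; apply; exact: ler_norm.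
split => //; apply: le_trans (le_normr_Rintegral measurableT hi) _.
apply: le_trans (ae_le_Rintegral (integrable_norm hi) bi hb) _.
rewrite (RintegralD measurableT (intgZ (4 / t) w2i) (intgZ t Qi)).
by rewrite (RintegralZl _ measurableT w2i) (RintegralZl _ measurableT Qi) mulrAC.
Qed.

(** Otherwise m would vanish almost everywhere and [W] would be 0. The strictness of the final
    inequality rests on this, since [Q] is only known to be nonnegative. *)
Lemma dist_sq_sq_gt0 : 0 < W -> 0 < \int[mu2]_p dist_sq p ^+ 2.
Proof.
move=> W0; have [w2i _] := dist_sq_sq_intg W0.
rewrite lt_def Rintegral_ge0 ?andbT; last by move=> p _; exact: sqr_ge0.
apply/eqP => /(Rintegral0_ae w2i (fun p => sqr_ge0 _)) w20.
have W_le0 : W <= \int[mu2]_p (0 * dist_sq p).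
  apply: (ae_le_Rintegral Wi (intgZ 0 Wi)); apply: aeS w20 => p /eqP.
  by rewrite sqrf_eq0 => /eqP ->; rewrite mul0r.
move: W_le0; rewrite (RintegralZl 0 measurableT Wi) mul0r.
by rewrite leNgt W0.
Qed.

End Energy.

Section ExtendedIntegrals.
Context d (T : measurableType d) (R : realType) (m : {measure set T -> \bar R}).

Lemma ge0_integrable_lty (f : T -> R) : measurable_fun setT f -> (forall x, 0 <= f x) ->
  (\int[m]_x (f x)%:E < +oo)%E -> m.-integrable setT (EFin \o f).
Proof.
move=> mf f0 fi; apply/integrableP; split; first exact/measurable_EFinP.
by under eq_integral do rewrite /= ger0_norm //.
Qed.

End ExtendedIntegrals.

(** * Choice of the threshold and absorption of the helicity *)

Lemma energy_e3_map (R : realType) (r : R) : Energy r (@e3_map R) (@zero_grad R) = 0%E.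
Proof.
have I0 (F : R * R -> R) : (forall p, F p = 0) -> (\int[@leb2 R]_p (F p)%:E = 0)%E.
  by move=> F0; under eq_integral do rewrite F0; exact: integral0.
rewrite /Energy /Dir /Hel /Pot !I0 ?mule0 ?adde0 // => p.
- by rewrite big1 ?expr0n // => i _; rewrite /e3_map subrr expr0n.
- by rewrite big1 // => i _; rewrite /e3_map subrr mul0r.
- by rewrite big1 // => i _; rewrite big1 // => j _; rewrite /zero_grad expr0n.
Qed.

Lemma lty_of_pmule_lty (R : realType) (c : R) (x : \bar R) : 0 < c ->
  (c%:E * x < +oo -> x < +oo)%E.
Proof. by move=> c0; case: x => [x||] //; rewrite ?ltry // gt0_muley ?lte_fin. Qed.

Theorem theorem1p3 (R : realType) (r : R) (hr : 0 < r) :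
  exists delta : R, 0 < delta /\
    forall (n : 'I_3 -> R * R -> R) (G : 'I_3 -> 'I_2 -> R * R -> R),
      sphere_map n ->
      (forall (i : 'I_3) (j : 'I_2), L2loc (G i j) /\ weak_deriv (n i) (G i j) j) ->
      (Dir G + Pot n < +oo)%E ->
      (0 < L2dist_e3 n)%E -> (L2dist_e3 n <= delta%:E)%E ->
      (Energy r (@e3_map R) (@zero_grad R) < Energy r n G)%E.
Proof.
(* Chosen so that [65 * r * delta = 65 / 200], which is below the coefficient 1/2 of the Dirichlet
   term; the 65 arises from the bound on [H] below. *)
pose delta : R := (200 * r)^-1.
have d0 : 0 < delta by rewrite invr_gt0 mulr_gt0.
exists delta; split => // n G nS nG DV dist_gt0 dist_le.
have w0 := dist_sq_ge0 n; have q0 := grad_sq_ge0 G.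
have Qi : (lebesgue_measure \x lebesgue_measure)%E.-integrable setT (EFin \o grad_sq G).
  apply: ge0_integrable_lty => //; first exact: measurable_grad_sq nG.
  apply: (@lty_of_pmule_lty _ 2^-1); first by rewrite invr_gt0.
  apply: le_lt_trans DV; rewrite leeDl // mule_ge0 ?lee_fin //.
  by apply: integral_ge0 => p _; rewrite lee_fin sqr_ge0.
have Wi : (lebesgue_measure \x lebesgue_measure)%E.-integrable setT (EFin \o dist_sq n).
  apply: ge0_integrable_lty => //; first exact: measurable_dist_sq nS.
  apply: (@lty_poweRy _ _ 2^-1); first by rewrite invr_eq0.
  exact: le_lt_trans dist_le (ltry _).
have L2E : L2dist_e3 n = (Num.sqrt (\int[@leb2 R]_p dist_sq n p)%R)%:E.
  rewrite /L2dist_e3 [X in poweR X _](EFin_Rintegral Wi) poweR_EFin.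
  by rewrite powR12_sqrt // Rintegral_ge0.
rewrite L2E lte_fin sqrtr_gt0 in dist_gt0; rewrite L2E lee_fin in dist_le.
set W := (\int[@leb2 R]_p dist_sq n p)%R in dist_gt0 dist_le.
have WE : W = (Num.sqrt W) ^+ 2 by rewrite sqr_sqrtr // ltW.
have W_le : W <= delta ^+ 2.
  by rewrite WE ler_pXn2r ?nnegrE ?sqrtr_ge0 // ltW.
pose Q := (\int[@leb2 R]_p grad_sq G p)%R.
pose V := (\int[@leb2 R]_p dist_sq n p ^+ 2)%R.
pose H := (\int[@leb2 R]_p helicity n G p)%R.
have [w2i w2_le] : _ /\ V <= 16 * (W * Q) := dist_sq_sq_intg nS nG Wi Qi dist_gt0.
have w2_gt0 : 0 < V := dist_sq_sq_gt0 nS nG Wi Qi dist_gt0.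
have [hi h_le] : _ /\ `|H| <= 4 * V / delta + delta * Q :=
  helicity_estimate nS nG Wi Qi d0 dist_gt0.
have Q0 : 0 <= Q by apply: Rintegral_ge0.
rewrite energy_e3_map /Energy /Dir /Hel /Pot.
rewrite [X in (_ * X + _ + _)%E](EFin_Rintegral Qi).
rewrite [X in (_ + _ * X + _)%E](EFin_Rintegral hi).
rewrite [X in (_ + _ + _ * X)%E](EFin_Rintegral w2i).
rewrite -!EFinM -!EFinD lte_fin.
suff : 0 < 2^-1 * Q + r * H + 8^-1 * V by [].
(* The Young parameter is [delta] itself: [V <= 16 * delta^2 * Q] turns the first term into at most
   [64 * delta * Q], and the second adds one more [delta * Q]. *)
have h_le' : `|H| <= 65 * delta * Q.
  apply: le_trans h_le _; rewrite -lerBrDr ler_pdivrMr //.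
  have WQ : W * Q <= delta ^+ 2 * Q by rewrite ler_wpM2r.
  by lra.
have rd : r * delta = 200^-1 by rewrite /delta; field; rewrite gt_eqF.
have : r * `|H| <= r * (65 * delta * Q) by rewrite ler_pM2l.
have -> : r * (65 * delta * Q) = 65 * (r * delta) * Q by ring.
rewrite rd => rH; have : - (r * H) <= r * `|H|.
  by rewrite -mulrN ler_pM2l // -normrN ler_norm.
lra.
Qed.
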